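(* Let $d\ge1$ be an integer and $0\le\alpha\le1/10$. Consider the casino game baccara chemin de fer under Model B3 with $d$ decks and commission $\alpha$, i.e. the $2^5\times2^{484}$ bimatrix game $(\boldsymbol{A},\boldsymbol{B})$ defined in the context, with functions $p(h,k)$ (of $\alpha$, for fixed $d$) as defined there. **Special values of $\alpha$.** Let $\beta_1$ (for $d=1$) be the $\alpha\in(0,1/10)$ at which $p((8,8),\varnothing)$ intersects $p((5,8),8)$. Let $\beta_0$ (for $4\le d\le12$), $\beta_2,\beta_3$ (for $d=2$), $\beta_4$ (for $d=8,9$), $\beta_5$ (for $d=9,10,11$) be the $\alpha\in(0,1/10)$ at which $p((0,6),\varnothing)$ intersects, respectively, $p((3,3),6)$, $p((6,9),4)$, $p((0,5),4)$, $p((1,4),4)$, $p((2,3),4)$. (Approximately: $\beta_0\approx0.0120709,\,0.0392263,\,0.0569147,\,0.0693518,\,0.0785740,\,0.0856851,\,0.0913356,\,0.0959335,\,0.0997480$ for $d=4,\ldots,12$; $\beta_1\approx0.0655294$; $\beta_2\approx0.0046904$; $\beta_3\approx0.0281623$; $\beta_4\approx0.0244435,\,0.0763202$ for $d=8,9$; $\beta_5\approx0.0056651,\,0.0544215,\,0.0932285$ for $d=9,10,11$.) Thus the number of special values is three if $d=9$, two if $d\in\{2,8,10,11\}$, one if $d\in\{1,4,5,6,7,12\}$, and none otherwise. **Conclusion.** For $\alpha\in[0,1/10]$ not a special value for $d$, there is a Nash equilibrium of the following form. Player draws at $(0,5)$, $(6,9)$, and $(7,8)$, stands at $(2,3)$,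 and mixes at $(1,4)$, drawing there with probability $$p=\frac{(12d-1)(16d^2-14d+1)+8\alpha d(112d^2-24d+1)}{32d^2(11d-1)-16d^2\alpha(12d-1)}\quad\text{if }d\ge2,\qquad p=\frac{4+203\alpha}{2(38-21\alpha)}\quad\text{if }d=1.$$ Banker's equilibrium strategy is as follows (D = draw, S = stand, M = mix, i.e. draw with probability $q$ and stand with probability $1-q$; since there is a single M, this is the mixture with weights $1-q$ and $q$ of two pure strategies). With Banker's two-card total $j$ and Player's third card $k$ ($k=\varnothing$ if Player stands): - $j\in\{0,1,2\}$: D for all $k$. - $j=3$: D for $k\in\{0,\ldots,7,9,\varnothing\}$. - $j=4$: S for $k\in\{0,8,9\}$; D for $k\in\{2,\ldots,7,\varnothing\}$. - $j=5$: S for $k\in\{0,1,2,3,8,9\}$; D for $k\in\{5,6,7,\varnothing\}$. - $j=6$: S for $k\in\{0,\ldots,5,8,9\}$; D for $k=7$. - $j=7$: S for all $k$. - In the remaining cases $(j,k)=(3,8),(4,1),(5,4),(6,\varnothing),(6,6)$ the move depends on the composition of Banker's hand, and is given by the following five-block words; the blocks correspond to $(3,8)$, $(4,1)$, $(5,4)$, $(6,\varnothing)$, $(6,6)$ in this order, and within a block the letters correspond to the compositions in the order: total 3: $(0,3),(1,2),(4,9),(5,8),(6,7)$; total 4: $(0,4),(1,3),(2,2),(5,9),(6,8),(7,7)$; total 5: $(0,5),(1,4),(2,3),(6,9),(7,8)$; total 6: $(0,6),(1,5),(2,4),(3,3),(7,9),(8,8)$. Write $\Gamma_d=256d^2(11d-1)(52d-5)$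 and $$q_1=\tfrac{92160d^4-120128d^3+26336d^2-2000d+47}{\Gamma_d},\quad q_2=\tfrac{91776d^4-119968d^3+26320d^2-2000d+47}{\Gamma_d},$$ $$q_3=\tfrac{91904d^4-119680d^3+26064d^2-1932d+41}{\Gamma_d},\quad q_4=\tfrac{91648d^4-119488d^3+26032d^2-1932d+41}{\Gamma_d},$$ $$q_5=\tfrac{91520d^4-119520d^3+26048d^2-1932d+41}{\Gamma_d}.$$ - $d=1$: $\alpha\in[0,\beta_1)$: SSDSD-SSSSDD-SSSSS-SSSSSM-DDDSDD, $q=4519/10716$; $\alpha\in(\beta_1,1/10]$: SSDDD-SSSSDD-SSSSS-SSSSSM-DDDSDD, $q=3991/10716$. - $d=2$: $\alpha\in[0,\beta_2)$: SSSSS-SSSSDD-DSSDD-MSSSSD-DDDSDD, $q=17431/64512$; $\alpha\in(\beta_2,\beta_3)$: SSSSS-SSSSDD-DSSSD-MSSSSD-DDDSDD, $q=192637/709632$; $\alpha\in(\beta_3,1/10]$: SSSSS-SSSSDD-SSSSD-MSSSSD-DDDSDD, $q=65407/236544$. - $d=3$: $\alpha\in[0,1/10]$: SSSSS-SSSSSS-DSSDD-MSSSSD-DDDSDD, $q=q_2$. - $4\le d\le7$: $\alpha\in[0,\beta_0)$: SSSSS-SSSSSS-DSSDD-MSSSSD-DDDDDD, $q=q_1$; $\alpha\in(\beta_0,1/10]$: SSSSS-SSSSSS-DSSDD-MSSSSD-DDDSDD, $q=q_2$. - $d=8$: $\alpha\in[0,\beta_4)$: SSSSS-SSSSSS-DDSDD-MSSSSD-DDDDDD,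 $q=q_3$; $\alpha\in(\beta_4,\beta_0)$: SSSSS-SSSSSS-DSSDD-MSSSSD-DDDDDD, $q=q_1$; $\alpha\in(\beta_0,1/10]$: SSSSS-SSSSSS-DSSDD-MSSSSD-DDDSDD, $q=q_2$. - $d=9$: $\alpha\in[0,\beta_5)$: SSSSS-SSSSSS-DDDDD-MSSSSD-DDDDDD, $q=q_4$; $\alpha\in(\beta_5,\beta_4)$: SSSSS-SSSSSS-DDSDD-MSSSSD-DDDDDD, $q=q_3$; $\alpha\in(\beta_4,\beta_0)$: SSSSS-SSSSSS-DSSDD-MSSSSD-DDDDDD, $q=q_1$; $\alpha\in(\beta_0,1/10]$: SSSSS-SSSSSS-DSSDD-MSSSSD-DDDSDD, $q=q_2$. - $d=10,11$: $\alpha\in[0,\beta_5)$: SSSSS-SSSSSS-DDDDD-MSSSSD-DDDDDD, $q=q_4$; $\alpha\in(\beta_5,\beta_0)$: SSSSS-SSSSSS-DDSDD-MSSSSD-DDDDDD, $q=q_3$; $\alpha\in(\beta_0,1/10]$: SSSSS-SSSSSS-DDSDD-MSSSSD-DDDSDD, $q=q_5$. - $d=12$: $\alpha\in[0,\beta_0)$: SSSSS-SSSSSS-DDDDD-MSSSSD-DDDDDD, $q=q_4$; $\alpha\in(\beta_0,1/10]$: SSSSS-SSSSSS-DDDDD-MSSSSD-DDDSDD, $q=1689974681/2989264896$. - $d\ge13$: $\alpha\in[0,1/10]$: SSSSS-SSSSSS-DDDDD-MSSSSD-DDDDDD, $q=q_4$. If $\alpha$ is one of the special values for $d$, then multiple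 Nash equilibria exist: when Player's equilibrium strategy is to draw at $(0,5)$, $(6,9)$, and $(7,8)$, stand at $(2,3)$, and mix at $(1,4)$, drawing there with probability $$p=\frac{(12d-1)(16d^2-14d+1)+8\alpha d(112d^2-24d+1)}{32d^2(11d-1)-16d^2\alpha(12d-1)}\quad\text{if }d\ge2,\qquad p=\frac{4+203\alpha}{2(38-21\alpha)}\quad\text{if }d=1,$$ Banker has four equilibrium strategies of support size $2$.
   Context: **Cards and hands.** Card values are $0,1,\ldots,9$; the $d$-deck shoe of $52d$ cards has $N_0=16d$ cards of value $0$ and $N_k=4d$ cards of each value $k\in\{1,\ldots,9\}$. $M(i)$ denotes the remainder of the nonnegative integer $i$ on division by $10$. A two-card hand is a pair $(i_1,i_2)$ with $0\le i_1\le i_2\le 9$; its total is $M(i_1+i_2)$. Let $H$ be the set of hands with total at most $7$ (there are $44$). Cards are dealt without replacement. With $\delta$ the Kronecker delta, set $$p_4((i_1,i_2),(j_1,j_2))=(2-\delta_{i_1,i_2})\frac{N_{i_1}}{52d}\cdot\frac{N_{i_2}-\delta_{i_2,i_1}}{52d-1}\cdot(2-\delta_{j_1,j_2})\frac{N_{j_1}-\delta_{j_1,i_1}-\delta_{j_1,i_2}}{52d-2}\cdot\frac{N_{j_2}-\delta_{j_2,i_1}-\delta_{j_2,i_2}-\delta_{j_2,j_1}}{52d-3}$$ (probability that Player's hand is $(i_1,i_2)$ and Banker's is $(j_1,j_2)$), $$p_5((i_1,i_2),(j_1,j_2),k)=p_4((i_1,i_2),(j_1,j_2))\frac{N_k-\delta_{k,i_1}-\delta_{k,i_2}-\delta_{k,j_1}-\delta_{k,j_2}}{52d-4},$$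 $$p_6((i_1,i_2),(j_1,j_2),k,l)=p_5((i_1,i_2),(j_1,j_2),k)\frac{N_l-\delta_{l,i_1}-\delta_{l,i_2}-\delta_{l,j_1}-\delta_{l,j_2}-\delta_{l,k}}{52d-5},$$ for $k,l\in\{0,\ldots,9\}$ (fifth and sixth cards dealt). **Rules (informal).** If either two-card total is 8 or 9 the game ends and the higher total wins. Otherwise Player draws a third card (face up) on totals 0–4, stands on 6–7, and may choose on 5, seeing the composition of his two-card hand; then Banker, seeing the composition of his own two-card hand and Player's third card $k$ ($\varnothing$ if Player stood), stands or draws. The higher total (mod 10) wins one unit; ties push. Banker pays a commission $\alpha$ on each win. **Pure strategies.** Player's pure strategies are $u\in\{0,1,\ldots,31\}$, written in binary as $u=16u_1+8u_2+4u_3+2u_4+u_5$, $u_i\in\{0,1\}$. Let $S_u$ consist of all hands in $H$ with total at most $4$, together with $(0,5)$ if $u_1=1$, $(1,4)$ if $u_2=1$, $(2,3)$ if $u_3=1$, $(6,9)$ if $u_4=1$, and $(7,8)$ if $u_5=1$; Player using $u$ draws on hands in $S_u$ and stands on hands in $S_u^c=H\setminus S_u$. Banker's pure strategies are the subsets $T\subset H\times\{0,1,\ldots,9,\varnothing\}$ (the $484$ information sets), where $T$ is the set of information sets at which Banker draws; $T^c$ is the complement. Player drawing at $(1,4)$ with probability $p$, drawing at $(0,5),(6,9),(7,8)$ and standing at $(2,3)$ means the mixed strategy with weight $1-p$ on $u=19$ and weight $p$ on $u=27$. **Payoffs.** Let $f(x)=1-\alpha$ if $x>0$, $f(0)=0$,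 $f(x)=-1$ if $x<0$. For $h=(j_1,j_2)\in H$ and $k\in\{0,\ldots,9\}$, let $$p_u(h,k)=\sum_{g\in S_u}p_5(g,h,k),\qquad p_u(h,\varnothing)=\sum_{g\in S_u^c}p_4(g,h),$$ and, writing $g=(i_1,i_2)$, $$b_{u,0}(h,k)=\frac1{p_u(h,k)}\sum_{g\in S_u}f\big(M(j_1+j_2)-M(i_1+i_2+k)\big)p_5(g,h,k),$$ $$b_{u,1}(h,k)=\frac1{p_u(h,k)}\sum_{g\in S_u}\sum_{l=0}^9f\big(M(j_1+j_2+l)-M(i_1+i_2+k)\big)p_6(g,h,k,l),$$ $$b_{u,0}(h,\varnothing)=\frac1{p_u(h,\varnothing)}\sum_{g\in S_u^c}f\big(M(j_1+j_2)-M(i_1+i_2)\big)p_4(g,h),$$ $$b_{u,1}(h,\varnothing)=\frac1{p_u(h,\varnothing)}\sum_{g\in S_u^c}\sum_{l=0}^9f\big(M(j_1+j_2+l)-M(i_1+i_2)\big)p_5(g,h,l).$$ These are Banker's conditional expectations from standing (second index $0$) and drawing (second index $1$). Banker's payoff is $$b_{u,T}=-\frac{32\alpha d^2(37120d^2-4044d+109)}{52d(52d-1)(52d-2)(52d-3)}+\sum_{(h,k)\in T^c}p_u(h,k)b_{u,0}(h,k)+\sum_{(h,k)\in T}p_u(h,k)b_{u,1}(h,k),$$ where $k$ ranges over $\{0,\ldots,9,\varnothing\}$ (the first term is $-\alpha$ times the probability that Banker wins with a two-card total of 8 or 9). Player's payoff $a_{u,T}$ is $-b_{u,T}$ evaluated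 with $\alpha=0$. The bimatrix game has Player as row player with payoff matrix $\boldsymbol{A}=(a_{u,T})$ and Banker as column player with payoff matrix $\boldsymbol{B}=(b_{u,T})$. Nash equilibria are in mixed strategies. **Best-response-discontinuity functions (rows 19 and 27).** For an information set $(h,k)$, $$p(h,k)=\frac{p_{19}(h,k)[b_{19,1}(h,k)-b_{19,0}(h,k)]}{p_{19}(h,k)[b_{19,1}(h,k)-b_{19,0}(h,k)]-p_{27}(h,k)[b_{27,1}(h,k)-b_{27,0}(h,k)]},$$ regarded, for fixed $d$, as a function of $\alpha$, at those $\alpha$ for which the differences $b_{u,1}(h,k)-b_{u,0}(h,k)$, $u=19,27$, are weakly of opposite signs and not both zero (so that the value lies in $[0,1]$). *)

(* Defs.v *)
From mathcomp Require Import all_boot all_order all_algebra.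
From mathcomp Require Import classical_sets reals.

Set Implicit Arguments.
Unset Strict Implicit.
Unset Printing Implicit Defensive.
Set Warnings "-abstract-large-number".

Import Order.TTheory GRing.Theory Num.Theory.
Local Open Scope ring_scope.

Section BimatrixGame.
Variables (R : realType) (P Q : finType).

Definition mixed (T : finType) (x : {ffun T -> R}) : Prop :=
  (forall t, 0 <= x t) /\ \sum_t x t = 1.

Definition expected (W : P -> Q -> R) (x : {ffun P -> R}) (y : {ffun Q -> R}) :=
  \sum_u \sum_v x u * y v * W u v.

Definition nash (A B : P -> Q -> R) (x : {ffun P -> R}) (y : {ffun Q -> R}) :=
  [/\ mixed x, mixed y,
      forall x', mixed x' -> expected A x' y <= expected A x y &
      forall y', mixed y' -> expected B x y' <= expected B x y].

Definition mix2 (T : finType) (s t : T) (w : R) : {ffun T -> R} :=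
  [ffun v => (1 - w) * (v == s)%:R + w * (v == t)%:R].

End BimatrixGame.

Definition M10 (i : nat) : nat := (i %% 10)%N.

(* The set H of 44 hands, as a finite type. *)
Definition hand : finType :=
  {g : 'I_10 * 'I_10 | (g.1 <= g.2)%N && (M10 (g.1 + g.2) <= 7)%N}.

Definition pips (g : hand) : nat * nat :=
  (nat_of_ord (val g).1, nat_of_ord (val g).2).

Definition total (g : hand) : nat := M10 ((pips g).1 + (pips g).2).

(* [None] encodes the empty third card: Player stood. *)
Definition infoset : finType := (hand * option 'I_10)%type.

Notation card_lit k := (@Ordinal 10 k isT).
Notation hand_lit i j := (@exist ('I_10 * 'I_10) _ (card_lit i, card_lit j) isT : hand).
Notation infoset_lit i j k := ((hand_lit i j, Some (card_lit k)) : infoset).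
Notation infoset_stood i j := ((hand_lit i j, None) : infoset).

(* [digit u i] is u_i in u = 16 u_1 + 8 u_2 + 4 u_3 + 2 u_4 + u_5. *)
Definition digit (u i : nat) : bool := odd (u %/ 2 ^ (5 - i))%N.

Definition draws (u : nat) : {set hand} :=
  [set g | [|| (total g <= 4)%N,
               (pips g == (0, 5)%N) && digit u 1,
               (pips g == (1, 4)%N) && digit u 2,
               (pips g == (2, 3)%N) && digit u 3,
               (pips g == (6, 9)%N) && digit u 4 |
               (pips g == (7, 8)%N) && digit u 5]].

Section Payoffs.
Variables (R : realType) (d : nat).

Definition shoe (k : nat) : R := if k == 0%N then (16 * d)%:R else (4 * d)%:R.

Definition delta (i j : nat) : R := (i == j)%:R.

Local Notation dR := (d%:R : R).

Definition p4 (g h : hand) : R :=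
  let: (i1, i2) := pips g in let: (j1, j2) := pips h in
  (2 - delta i1 i2) * (shoe i1 / (52 * dR))
  * ((shoe i2 - delta i2 i1) / (52 * dR - 1))
  * (2 - delta j1 j2) * ((shoe j1 - delta j1 i1 - delta j1 i2) / (52 * dR - 2))
  * ((shoe j2 - delta j2 i1 - delta j2 i2 - delta j2 j1) / (52 * dR - 3)).

Definition p5 (g h : hand) (k : 'I_10) : R :=
  let: (i1, i2) := pips g in let: (j1, j2) := pips h in
  p4 g h
  * ((shoe k - delta k i1 - delta k i2 - delta k j1 - delta k j2)
     / (52 * dR - 4)).

Definition p6 (g h : hand) (k l : 'I_10) : R :=
  let: (i1, i2) := pips g in let: (j1, j2) := pips h in
  p5 g h k
  * ((shoe l - delta l i1 - delta l i2 - delta l j1 - delta l j2 - delta l k)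
     / (52 * dR - 5)).

(* f applied to Banker's final total minus Player's final total. *)
Definition win (alpha : R) (banker player : nat) : R :=
  let x : int := banker%:Z - player%:Z in
  if 0 < x then 1 - alpha else if x == 0 then 0 else -1.

Definition pu (u : nat) (x : infoset) : R :=
  match x with
  | (h, Some k) => \sum_(g in draws u) p5 g h k
  | (h, None) => \sum_(g in ~: draws u) p4 g h
  end.

Definition b0 (alpha : R) (u : nat) (x : infoset) : R :=
  (pu u x)^-1 *
  match x with
  | (h, Some k) =>
      \sum_(g in draws u)
        win alpha (M10 ((pips h).1 + (pips h).2))
                  (M10 ((pips g).1 + (pips g).2 + k)) * p5 g h k
  | (h, None) =>
      \sum_(g in ~: draws u)
        win alpha (M10 ((pips h).1 + (pips h).2))
                  (M10 ((pips g).1 + (pips g).2)) * p4 g h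
  end.

Definition b1 (alpha : R) (u : nat) (x : infoset) : R :=
  (pu u x)^-1 *
  match x with
  | (h, Some k) =>
      \sum_(g in draws u) \sum_(l < 10)
        win alpha (M10 ((pips h).1 + (pips h).2 + l))
                  (M10 ((pips g).1 + (pips g).2 + k)) * p6 g h k l
  | (h, None) =>
      \sum_(g in ~: draws u) \sum_(l < 10)
        win alpha (M10 ((pips h).1 + (pips h).2 + l))
                  (M10 ((pips g).1 + (pips g).2)) * p5 g h l
  end.

Definition banker_payoff (alpha : R) (u : 'I_32) (T : {set infoset}) : R :=
  - (32 * alpha * dR ^+ 2 * (37120%:R * dR ^+ 2 - 4044 * dR + 109))
    / (52 * dR * (52 * dR - 1) * (52 * dR - 2) * (52 * dR - 3))
  + \sum_(x in ~: T) pu u x * b0 alpha u x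
  + \sum_(x in T) pu u x * b1 alpha u x.

Definition player_payoff (u : 'I_32) (T : {set infoset}) : R :=
  - banker_payoff 0 u T.

Definition baccara_nash (alpha : R) :=
  nash player_payoff (banker_payoff alpha).

Definition gain (alpha : R) (u : nat) (x : infoset) : R :=
  b1 alpha u x - b0 alpha u x.

Definition disc_dom (x : infoset) (alpha : R) : bool :=
  (gain alpha 19 x * gain alpha 27 x <= 0)
  && ((gain alpha 19 x != 0) || (gain alpha 27 x != 0)).

Definition disc (x : infoset) (alpha : R) : R :=
  (pu 19 x * gain alpha 19 x)
  / (pu 19 x * gain alpha 19 x - pu 27 x * gain alpha 27 x).

Definition crossing (x y : infoset) (a : R) : Prop :=
  [/\ 0 < a < 1 / 10, disc_dom x a, disc_dom y a & disc x a = disc y a].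

Definition is_beta0 := crossing (infoset_stood 0 6) (infoset_lit 3 3 6).
Definition is_beta1 := crossing (infoset_stood 8 8) (infoset_lit 5 8 8).
Definition is_beta2 := crossing (infoset_stood 0 6) (infoset_lit 6 9 4).
Definition is_beta3 := crossing (infoset_stood 0 6) (infoset_lit 0 5 4).
Definition is_beta4 := crossing (infoset_stood 0 6) (infoset_lit 1 4 4).
Definition is_beta5 := crossing (infoset_stood 0 6) (infoset_lit 2 3 4).

(* [xget 0 E] is an element of E; it is the only one where the number of decks
   makes E a singleton, and it is used only there. *)
Definition beta0 : R := xget 0 is_beta0.
Definition beta1 : R := xget 0 is_beta1.
Definition beta2 : R := xget 0 is_beta2.
Definition beta3 : R := xget 0 is_beta3.
Definition beta4 : R := xget 0 is_beta4.
Definition beta5 : R := xget 0 is_beta5.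

Definition special_values : seq R :=
  if d == 1%N then [:: beta1]
  else if d == 2%N then [:: beta2; beta3]
  else if d == 3%N then [::]
  else if (d <= 7)%N then [:: beta0]
  else if d == 8%N then [:: beta4; beta0]
  else if d == 9%N then [:: beta5; beta4; beta0]
  else if (d <= 11)%N then [:: beta5; beta0]
  else if d == 12%N then [:: beta0]
  else [::].

(* x equals n * 10^-7 to seven decimal places. *)
Definition rounds_to (x : R) (n : nat) : Prop :=
  `|x - n%:R / 10 ^+ 7| <= 1 / (2 * 10 ^+ 7).

Definition player_prob (alpha : R) : R :=
  if d == 1%N then (4 + 203 * alpha) / (2 * (38 - 21 * alpha))
  else ((12 * dR - 1) * (16 * dR ^+ 2 - 14 * dR + 1)
        + 8 * alpha * dR * (112 * dR ^+ 2 - 24 * dR + 1))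
       / (32 * dR ^+ 2 * (11 * dR - 1) - 16 * dR ^+ 2 * alpha * (12 * dR - 1)).

Definition player_mix (alpha : R) : {ffun 'I_32 -> R} :=
  mix2 (@Ordinal 32 19 isT) (@Ordinal 32 27 isT) (player_prob alpha).

End Payoffs.

Inductive move := Stand | Draw | Mix.

(* The five blocks of a word, in the order of [open_cases]. *)
Definition word := seq (seq move).

Definition open_cases : seq (nat * option nat) :=
  [:: (3, Some 8); (4, Some 1); (5, Some 4); (6, None); (6, Some 6)]%N.

Definition compositions (j : nat) : seq (nat * nat) :=
  match j with
  | 3 => [:: (0, 3); (1, 2); (4, 9); (5, 8); (6, 7)]
  | 4 => [:: (0, 4); (1, 3); (2, 2); (5, 9); (6, 8); (7, 7)]
  | 5 => [:: (0, 5); (1, 4); (2, 3); (6, 9); (7, 8)]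
  | 6 => [:: (0, 6); (1, 5); (2, 4); (3, 3); (7, 9); (8, 8)]
  | _ => [::]
  end%N.

(* Relevant only outside [open_cases]. *)
Definition closed_move (j : nat) (k : option nat) : move :=
  let drawing :=
    match j with
    | 0 | 1 | 2 | 3 => true
    | 4 => k \notin [:: Some 0; Some 8; Some 9]
    | 5 => k \notin [:: Some 0; Some 1; Some 2; Some 3; Some 8; Some 9]
    | 6 => k == Some 7
    | _ => false
    end%N in
  if drawing then Draw else Stand.

Definition move_at (w : word) (x : infoset) : move :=
  let j := total x.1 in
  let k := omap (@nat_of_ord 10) x.2 in
  if (j, k) \in open_cases
  then nth Stand (nth [::] w (index (j, k) open_cases))
                 (index (pips x.1) (compositions j))
  else closed_move j k.

Definition banker_mix (R : realType) (w : word) (q : R) :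
    {ffun {set infoset} -> R} :=
  mix2 [set x | if move_at w x is Draw then true else false]
       [set x | if move_at w x is Stand then false else true] q.

Section Table.
Variables (R : realType) (d : nat).

Local Notation dR := (d%:R : R).
Local Notation D := Draw.
Local Notation S := Stand.
Local Notation M := Mix.

Definition Gam : R := 256 * dR ^+ 2 * (11 * dR - 1) * (52 * dR - 5).

Definition q1 : R :=
  (92160%:R * dR ^+ 4 - 120128%:R * dR ^+ 3 + 26336%:R * dR ^+ 2
   - 2000 * dR + 47) / Gam.
Definition q2 : R :=
  (91776%:R * dR ^+ 4 - 119968%:R * dR ^+ 3 + 26320%:R * dR ^+ 2
   - 2000 * dR + 47) / Gam.
Definition q3 : R :=
  (91904%:R * dR ^+ 4 - 119680%:R * dR ^+ 3 + 26064%:R * dR ^+ 2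
   - 1932 * dR + 41) / Gam.
Definition q4 : R :=
  (91648%:R * dR ^+ 4 - 119488%:R * dR ^+ 3 + 26032%:R * dR ^+ 2
   - 1932 * dR + 41) / Gam.
Definition q5 : R :=
  (91520%:R * dR ^+ 4 - 119520%:R * dR ^+ 3 + 26048%:R * dR ^+ 2
   - 1932 * dR + 41) / Gam.

Definition SSSSS := [:: S; S; S; S; S].
Definition SSDSD := [:: S; S; D; S; D].
Definition SSDDD := [:: S; S; D; D; D].
Definition DSSDD := [:: D; S; S; D; D].
Definition DSSSD := [:: D; S; S; S; D].
Definition SSSSD := [:: S; S; S; S; D].
Definition DDSDD := [:: D; D; S; D; D].
Definition DDDDD := [:: D; D; D; D; D].
Definition SSSSSS := [:: S; S; S; S; S; S].
Definition SSSSDD := [:: S; S; S; S; D; D].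
Definition SSSSSM := [:: S; S; S; S; S; M].
Definition MSSSSD := [:: M; S; S; S; S; D].
Definition DDDSDD := [:: D; D; D; S; D; D].
Definition DDDDDD := [:: D; D; D; D; D; D].

Definition equilibrium_entry (alpha : R) : word * R :=
  if d == 1%N then
    if alpha < beta1 R d
    then ([:: SSDSD; SSSSDD; SSSSS; SSSSSM; DDDSDD], 4519%:R / 10716%:R)
    else ([:: SSDDD; SSSSDD; SSSSS; SSSSSM; DDDSDD], 3991%:R / 10716%:R)
  else if d == 2%N then
    if alpha < beta2 R d
    then ([:: SSSSS; SSSSDD; DSSDD; MSSSSD; DDDSDD], 17431%:R / 64512%:R)
    else if alpha < beta3 R d
    then ([:: SSSSS; SSSSDD; DSSSD; MSSSSD; DDDSDD], 192637%:R / 709632%:R)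
    else ([:: SSSSS; SSSSDD; SSSSD; MSSSSD; DDDSDD], 65407%:R / 236544%:R)
  else if d == 3%N then
    ([:: SSSSS; SSSSSS; DSSDD; MSSSSD; DDDSDD], q2)
  else if (d <= 7)%N then
    if alpha < beta0 R d
    then ([:: SSSSS; SSSSSS; DSSDD; MSSSSD; DDDDDD], q1)
    else ([:: SSSSS; SSSSSS; DSSDD; MSSSSD; DDDSDD], q2)
  else if d == 8%N then
    if alpha < beta4 R d
    then ([:: SSSSS; SSSSSS; DDSDD; MSSSSD; DDDDDD], q3)
    else if alpha < beta0 R d
    then ([:: SSSSS; SSSSSS; DSSDD; MSSSSD; DDDDDD], q1)
    else ([:: SSSSS; SSSSSS; DSSDD; MSSSSD; DDDSDD], q2)
  else if d == 9%N then
    if alpha < beta5 R d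
    then ([:: SSSSS; SSSSSS; DDDDD; MSSSSD; DDDDDD], q4)
    else if alpha < beta4 R d
    then ([:: SSSSS; SSSSSS; DDSDD; MSSSSD; DDDDDD], q3)
    else if alpha < beta0 R d
    then ([:: SSSSS; SSSSSS; DSSDD; MSSSSD; DDDDDD], q1)
    else ([:: SSSSS; SSSSSS; DSSDD; MSSSSD; DDDSDD], q2)
  else if (d <= 11)%N then
    if alpha < beta5 R d
    then ([:: SSSSS; SSSSSS; DDDDD; MSSSSD; DDDDDD], q4)
    else if alpha < beta0 R d
    then ([:: SSSSS; SSSSSS; DDSDD; MSSSSD; DDDDDD], q3)
    else ([:: SSSSS; SSSSSS; DDSDD; MSSSSD; DDDSDD], q5)
  else if d == 12%N then
    if alpha < beta0 R d
    then ([:: SSSSS; SSSSSS; DDDDD; MSSSSD; DDDDDD], q4)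
    else ([:: SSSSS; SSSSSS; DDDDD; MSSSSD; DDDSDD],
          1689974681%:R / 2989264896%:R)
  else ([:: SSSSS; SSSSSS; DDDDD; MSSSSD; DDDDDD], q4).

End Table.

(* Seven-decimal roundings of [special_values], in units of 10^-7. *)
Definition special_digits (d : nat) : seq nat :=
  match d with
  | 1 => [:: 655294]
  | 2 => [:: 46904; 281623]
  | 4 => [:: 120709]
  | 5 => [:: 392263]
  | 6 => [:: 569147]
  | 7 => [:: 693518]
  | 8 => [:: 244435; 785740]
  | 9 => [:: 56651; 763202; 856851]
  | 10 => [:: 544215; 913356]
  | 11 => [:: 932285; 959335]
  | 12 => [:: 997480]
  | _ => [::]
  end%N.

(* Main.v *)
(* Against Player's mixture p on u = 27 and 1 - p on u = 19, Banker's payoff is a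
   constant plus a sum, over the information sets at which he draws, of a mean
   excess of drawing over standing; against a fixed strategy of Banker, Player's
   payoff is a constant plus a sum over the hands on which he draws. So Banker's
   best responses are read off the signs of 484 excesses, and Player's off the
   signs of five edges, the one at (1,4) having to vanish. Cleared of denominators,
   an excess is a quadratic in alpha with coefficients in Z[y], y = 4 d, and an edge
   is a polynomial in y; both are computed by the kernel from the dealing
   probabilities. Signs on 0 <= alpha <= 1/10 follow from Bernstein coefficients,
   and signs for all large d from substituting y = y0 + z and looking at the
   coefficients in z. The value p makes one excess vanish identically; the special
   values of alpha are the roots of the few quadratics that change sign, where two
   information sets are indifferent and Banker has four optimal pure strategies. *)
From Stdlib Require Import BinInt.
Require Import Defs.
From mathcomp Require Import all_boot all_order all_algebra.
From mathcomp Require Import classical_sets reals.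
From mathcomp Require Import ring lra zify ssrZ.

Set Implicit Arguments.
Unset Strict Implicit.
Unset Printing Implicit Defensive.
Set Warnings "-abstract-large-number".

Import Order.TTheory GRing.Theory Num.Theory.
Local Open Scope ring_scope.

(** * Games *)

(** Banker's excess at an information set is affine in the probability p with which Player draws at
    (1,4), and its root is the value p(h,k) of the discontinuity function. The stated p is this root
    at (0,6) without third card, or at (8,8) without third card for one deck. Hence an intersection
    with another p(h,k) is the same as a zero of the excess there against the stated p. Player's
    payoff is free of commission, so his edges, and with them q, are constant between special
    values. At a special value Banker's moves at two sets, [x0] and [x1], are free. The edge at
    (1,4) has one strict sign for both optimal pure strategies that stand at [x0] and the other for
    both that draw there. Of the six pairs of optimal pure strategies exactly the four that differ
    at [x0] can balance it, each with one weight. The size of the computation shapes the rest: most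
    information sets keep their sign for all d >= 2 and are certified together with y = 8 + z. Only
    the 28 sets of the five open cases need one certificate per deck number, and a last one with y =
    52 + z covers d >= 13. *)

Section BestResponse.
Variables (R : realType) (T : finType).
Implicit Types (x y : {ffun T -> R}) (v : T -> R).

Lemma mixed_mix2 (s t : T) (w : R) : 0 <= w <= 1 -> mixed (mix2 s t w).
Proof.
move=> /andP[w0 w1]; split=> [u|]; first by rewrite ffunE addr_ge0 // mulr_ge0 ?subr_ge0.
under eq_bigr do rewrite ffunE.
rewrite big_split /= -!mulr_sumr.
have sum1 a : \sum_(i : T) (i == a)%:R = 1 :> R.
  by rewrite (bigD1 a) //= eqxx big1 ?addr0 // => i /negPf ->.
by rewrite !sum1; ring.
Qed.

Lemma sum_mix2 (s t : T) (w : R) v :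
  \sum_u mix2 s t w u * v u = (1 - w) * v s + w * v t.
Proof.
under eq_bigr do rewrite ffunE mulrDl -!mulrA.
rewrite big_split /= -!mulr_sumr.
have sumd a : \sum_(i : T) (i == a)%:R * v i = v a.
  by rewrite (bigD1 a) //= eqxx mul1r big1 ?addr0 // => i /negPf ->; rewrite mul0r.
by rewrite !sumd.
Qed.

Lemma mix2_neq0 (s t u : T) (w : R) : 0 < w < 1 -> s != t ->
  (mix2 s t w u != 0) = (u \in [set s; t]).
Proof.
move=> /andP[w0 w1] st; rewrite ffunE !inE.
have [->|us] := eqVneq u s; first by rewrite (negPf st) mulr0 addr0 mulr1 subr_eq0 gt_eqF.
by case: (eqVneq u t) => _; rewrite !(mulr0, mulr1, add0r) ?eqxx // gt_eqF.
Qed.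

(** Comparison with point masses shows that no value exceeds the mean of [v] under [x]; a mean equal
    to the maximum forces every point of nonzero weight to attain it. *)
Lemma best_responseP v x : mixed x ->
  (forall y, mixed y -> \sum_t y t * v t <= \sum_t x t * v t)
  <-> (forall t, x t != 0 -> forall s, v s <= v t).
Proof.
move=> [x0 x1]; split=> [best t xt s|supp y [y0 y1]].
  have le_m u : v u <= \sum_t x t * v t.
    (* The mixture of [u] with itself at weight 0 serves as the point mass at [u]. *)
    have := best _ (@mixed_mix2 u u 0 _).
    by rewrite sum_mix2 subr0 mul1r mul0r addr0; apply; rewrite lexx ler01.
  have [->//|neq] := eqVneq (v t) (\sum_t x t * v t).
  have /eqP : \sum_u x u * (\sum_t x t * v t - v u) = 0.
    under eq_bigr do rewrite mulrBr.
    by rewrite sumrB -mulr_suml x1 mul1r subrr.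
  rewrite psumr_eq0 => [/allP /(_ t)|u _]; last by rewrite mulr_ge0 ?subr_ge0.
  by rewrite mem_index_enum mulf_eq0 (negPf xt) subr_eq0 eq_sym (negPf neq) => /(_ isT).
have [t xt] : exists t, x t != 0.
  apply/existsP; apply: contraT; rewrite negb_exists => /forallP z.
  by move: (oner_neq0 R); rewrite -x1 big1 ?eqxx // => t _; apply/eqP/negbNE/z.
apply: (@le_trans _ _ (v t)).
  rewrite -[leRHS]mul1r -y1 mulr_suml; apply: ler_sum => s _.
  by apply: ler_wpM2l => //; apply: supp.
rewrite -[leLHS]mul1r -x1 mulr_suml; apply: ler_sum => s _.
have [->|xs] := eqVneq (x s) 0; first by rewrite !mul0r.
by apply: ler_wpM2l => //; apply: supp.
Qed.

(** Adding or removing a single element isolates the sign of its score; conversely the two sums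
    compare term by term. *)
Lemma subset_sum_maxP (f : T -> R) (A : {set T}) :
  (forall B : {set T}, \sum_(t in B) f t <= \sum_(t in A) f t)
  <-> (forall t, (0 < f t -> t \in A) /\ (f t < 0 -> t \notin A)).
Proof.
split=> [best t|sgn B].
  split=> ft.
    apply: contraT => tA; have := best (t |: A).
    by rewrite big_setU1 //= gerDr leNgt ft.
  apply/negP => tA; have := best (A :\ t).
  by rewrite [leRHS](big_setD1 t) //= lerDr leNgt ft.
rewrite big_mkcond [leRHS]big_mkcond; apply: ler_sum => t _ /=.
case: (sgn t) => pos neg; case: (ltgtP (f t) 0) => [/[dup] /neg/negPf -> /ltW| /[dup] /pos -> /ltW|->].
- by case: (t \in B).
- by case: (t \in B).
- by rewrite !if_same.
Qed.

End BestResponse.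

Section Nash.
Variables (R : realType) (P Q : finType).

Lemma expectedC (W : P -> Q -> R) x y :
  expected W x y = \sum_v y v * \sum_u x u * W u v.
Proof.
rewrite /expected exchange_big; apply: eq_bigr => v _ /=.
by rewrite mulr_sumr; apply: eq_bigr => u _; rewrite mulrCA mulrA.
Qed.

Lemma expectedE (W : P -> Q -> R) x y :
  expected W x y = \sum_u x u * \sum_v y v * W u v.
Proof. by apply: eq_bigr => u _; rewrite mulr_sumr; apply: eq_bigr => v _; rewrite mulrA. Qed.

Lemma nashP (A B : P -> Q -> R) x y : nash A B x y <->
  [/\ mixed x, mixed y,
    forall u, x u != 0 -> forall u', \sum_v y v * A u' v <= \sum_v y v * A u v &
    forall v, y v != 0 -> forall v', \sum_u x u * B u v' <= \sum_u x u * B u v].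
Proof.
split=> -[mx my bA bB]; split=> //.
- by apply/best_responseP => // x' /bA; rewrite !expectedE.
- by apply/best_responseP => // y' /bB; rewrite !expectedC.
- by move=> x' mx'; rewrite !expectedE; apply: (best_responseP _ mx).2 mx'.
- by move=> y' my'; rewrite !expectedC; apply: (best_responseP _ my).2 my'.
Qed.

End Nash.

(** * Separation of the payoffs *)

Lemma pips_inj : injective pips.
Proof.
move=> [[i j] gP] [[i' j'] gP'] [/= ii jj]; apply: val_inj => /=.
by congr (_, _); apply: val_inj.
Qed.

Lemma pips_eq (g h : hand) : (pips g == pips h) = (g == h).
Proof. exact: inj_eq pips_inj g h. Qed.

Definition five_hands : seq hand :=
  [:: hand_lit 0 5; hand_lit 1 4; hand_lit 2 3; hand_lit 6 9; hand_lit 7 8].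

Lemma in_draws u g : (g \in draws u) =
  [|| (Defs.total g <= 4)%N, (g == hand_lit 0 5) && digit u 1,
      (g == hand_lit 1 4) && digit u 2, (g == hand_lit 2 3) && digit u 3,
      (g == hand_lit 6 9) && digit u 4 | (g == hand_lit 7 8) && digit u 5].
Proof. by rewrite inE -!pips_eq. Qed.

(** In binary 19 is 10011 and 27 is 11011: only the digit of [(1, 4)] differs. *)
Lemma draws27 g : (g \in draws 27) = (g == hand_lit 1 4) || (g \in draws 19).
Proof.
have [] : [/\ digit 19 1 = true, digit 19 2 = false, digit 19 3 = false,
             digit 19 4 = true & digit 19 5 = true] by [].
have [] : [/\ digit 27 1 = true, digit 27 2 = true, digit 27 3 = false,
             digit 27 4 = true & digit 27 5 = true] by [].
rewrite !in_draws => -> -> -> -> -> -> -> -> -> ->; rewrite !andbT !andbF.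
move: (Defs.total g <= 4)%N (g == hand_lit 0 5) (g == hand_lit 1 4) => a b c.
move: (g == hand_lit 6 9) (g == hand_lit 7 8) => e f.
by case: a; case: b; case: c; case: e; case: f.
Qed.

Lemma notin_draws19 : (hand_lit 1 4 \in draws 19) = false.
Proof. by rewrite in_draws. Qed.

Definition active u (g : hand) (x : infoset) : bool :=
  if x.2 is Some _ then g \in draws u else g \notin draws u.

(** Moving a hand from standing to drawing adds it to the information sets with a third card and
    removes it from those without; this is the sign of that change. *)
Definition side (R : pzRingType) (o : option 'I_10) : R :=
  if o is Some _ then 1 else -1.
Arguments side R !o /.

Section Separation.
Variables (R : realType) (d : nat) (hd : (1 <= d)%N).
Implicit Types (g h : hand) (x : infoset) (alpha : R) (T : {set infoset}).

Local Notation dR := (d%:R : R).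

Definition prob g x : R :=
  match x with (h, Some k) => p5 R d g h k | (h, None) => p4 R d g h end.

Definition stand_val alpha g x : R :=
  match x with
  | (h, Some k) => win alpha (M10 ((pips h).1 + (pips h).2))
                             (M10 ((pips g).1 + (pips g).2 + k)) * p5 R d g h k
  | (h, None) => win alpha (M10 ((pips h).1 + (pips h).2))
                           (M10 ((pips g).1 + (pips g).2)) * p4 R d g h
  end.

Definition draw_val alpha g x : R :=
  match x with
  | (h, Some k) =>
      \sum_(l < 10) win alpha (M10 ((pips h).1 + (pips h).2 + l))
                      (M10 ((pips g).1 + (pips g).2 + k)) * p6 R d g h k l
  | (h, None) =>
      \sum_(l < 10) win alpha (M10 ((pips h).1 + (pips h).2 + l))
                      (M10 ((pips g).1 + (pips g).2)) * p5 R d g h l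
  end.

Definition excess alpha g x : R := draw_val alpha g x - stand_val alpha g x.

Definition total_excess alpha u x : R :=
  \sum_(g | active u g x) excess alpha g x.

Lemma dR_ge1 : 1 <= dR.
Proof. by rewrite ler1n. Qed.

Lemma delta01 i j : 0 <= delta R i j <= 1.
Proof. by rewrite /delta; case: eqP; rewrite ?lexx ?ler01. Qed.

Lemma shoe_ge4 k : 4 <= shoe R d k.
Proof. by rewrite /shoe; case: eqP => _; rewrite natrM; have := dR_ge1; lra. Qed.

Lemma deck_gt0 (n : nat) : (n < 52)%N -> 0 < 52 * dR - n%:R.
Proof.
by move=> n52; rewrite subr_gt0 (@lt_le_trans _ _ 52) ?ltr_nat // ler_peMr ?dR_ge1.
Qed.

Lemma shoe_left_ge0 k (s : seq nat) : (size s <= 4)%N ->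
  0 <= shoe R d k - \sum_(i <- s) delta R k i.
Proof.
move=> s4; rewrite subr_ge0; apply: le_trans (shoe_ge4 k).
apply: le_trans (_ : (size s)%:R <= 4); last by rewrite ler_nat.
elim: s {s4} => [|i s IHs]; first by rewrite big_nil.
by rewrite big_cons /= mulrS lerD //; case/andP: (delta01 k i).
Qed.

Lemma shoe_left_gt0 k i1 i2 (s : seq nat) : i1 != i2 -> (size s <= 2)%N ->
  0 < shoe R d k - \sum_(i <- i1 :: i2 :: s) delta R k i.
Proof.
move=> i12 s2; have dist : delta R k i1 + delta R k i2 <= 1.
  rewrite /delta; have [->|_] := eqVneq k i1; first by rewrite (negPf i12) addr0.
  by rewrite add0r; case: eqP; rewrite ?ler01.
have : \sum_(i <- s) delta R k i <= 2.
  apply: le_trans (_ : (size s)%:R <= 2); last by rewrite ler_nat.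
  elim: s {s2} => [|i s IHs]; first by rewrite big_nil.
  by rewrite big_cons /= mulrS lerD //; case/andP: (delta01 k i).
by rewrite !big_cons; have := shoe_ge4 k; lra.
Qed.

(** The Kronecker corrections are gathered into sums over the list of cards already seen, the shape
    shared by the sign lemmas and by the computed counts [left_poly]. *)
Lemma p4E g h : p4 R d g h =
  let: (i1, i2) := pips g in let: (j1, j2) := pips h in
  (2 - delta R i1 i2) * (2 - delta R j1 j2)
  * ((shoe R d i1 - \sum_(i <- [::]) delta R i1 i) / (52 * dR - 0%:R))
  * ((shoe R d i2 - \sum_(i <- [:: i1]) delta R i2 i) / (52 * dR - 1%:R))
  * ((shoe R d j1 - \sum_(i <- [:: i1; i2]) delta R j1 i) / (52 * dR - 2%:R))
  * ((shoe R d j2 - \sum_(i <- [:: i1; i2; j1]) delta R j2 i) / (52 * dR - 3%:R)).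
Proof.
rewrite /p4; case: (pips g) => i1 i2; case: (pips h) => j1 j2.
rewrite !(big_cons, big_nil) mulr0n mulr1n !addr0 !subr0 !opprD !addrA.
move: (2 - _) (2 - _) (shoe R d i1) (shoe R d i2 - _) (_ - delta R j1 i2) (_ - delta R j2 j1) => a b c e f g'.
by move: (52 * dR)^-1 (_ - 1 - 1 - 1)^-1 (_ - 1 - 1)^-1 (_ - 1)^-1 => *; ring.
Qed.

Lemma p5E g h k : p5 R d g h k =
  p4 R d g h * ((shoe R d k - \sum_(i <- [:: (pips g).1; (pips g).2; (pips h).1; (pips h).2])
                    delta R k i) / (52 * dR - 4%:R)).
Proof.
rewrite /p5; case: (pips g) => i1 i2; case: (pips h) => j1 j2.
by rewrite !(big_cons, big_nil) addr0 !opprD !addrA.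
Qed.

Lemma p6E g h k l : p6 R d g h k l =
  p5 R d g h k * ((shoe R d l -
      \sum_(i <- [:: (pips g).1; (pips g).2; (pips h).1; (pips h).2; nat_of_ord k])
        delta R l i) / (52 * dR - 5%:R)).
Proof.
rewrite /p6; case: (pips g) => i1 i2; case: (pips h) => j1 j2.
by rewrite !(big_cons, big_nil) addr0 !opprD !addrA.
Qed.

Lemma two_delta_gt0 i j : 0 < 2 - delta R i j.
Proof. by case/andP: (delta01 i j) => *; lra. Qed.

Lemma p4_ge0 g h : 0 <= p4 R d g h.
Proof.
rewrite p4E; case: (pips g) => i1 i2; case: (pips h) => j1 j2.
by rewrite !mulr_ge0 ?invr_ge0 ?shoe_left_ge0 // ltW ?two_delta_gt0 ?deck_gt0.
Qed.

Lemma p5_ge0 g h k : 0 <= p5 R d g h k.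
Proof.
rewrite p5E mulr_ge0 ?p4_ge0 // divr_ge0 ?shoe_left_ge0 //.
by rewrite ltW ?deck_gt0.
Qed.

(* A hand with two distinct cards leaves a positive count of every value after
   three more cards. *)
Lemma p4_gt0 g h : (pips g).1 != (pips g).2 -> 0 < p4 R d g h.
Proof.
rewrite p4E; case: (pips g) => i1 i2 /= i12; case: (pips h) => j1 j2.
rewrite !mulr_gt0 ?invr_gt0 ?two_delta_gt0 ?deck_gt0 ?shoe_left_gt0 //.
- by rewrite big_nil subr0; have := shoe_ge4 i1; lra.
- by rewrite big_seq1; have := shoe_ge4 i2; case/andP: (delta01 i2 i1) => *; lra.
Qed.

Lemma p5_gt0 g h k : (pips g).1 != (pips g).2 -> 0 < p5 R d g h k.
Proof.
move=> i12; rewrite p5E mulr_gt0 ?p4_gt0 // mulr_gt0 ?invr_gt0 ?deck_gt0 //.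
exact: shoe_left_gt0.
Qed.

Lemma puE u x : pu R d u x = \sum_(g | active u g x) prob g x.
Proof. by case: x => h [k|] //=; apply: eq_bigl => g; rewrite inE. Qed.

(** Positivity lets the weight [pu] cancel the normalisation in [b0] and [b1], which leaves plain
    sums over hands. *)
Lemma pu_gt0 u x : 0 < pu R d u x.
Proof.
have prob0 g : 0 <= prob g x by case: (x) => h [k|]; rewrite ?p4_ge0 ?p5_ge0.
have pos g : (pips g).1 != (pips g).2 -> 0 < prob g x.
  by move=> gP; case: (x) => h [k|]; [apply: p5_gt0 | apply: p4_gt0].
(* Under every [u] Player draws on [(0, 1)] and stands on [(0, 6)], and both hands have two distinct
   cards. *)
have [g gP ga] : exists2 g, (pips g).1 != (pips g).2 & active u g x.
  by case: (x) => h [k|]; [exists (hand_lit 0 1) | exists (hand_lit 0 6)];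
     rewrite // /active /= in_draws.
by rewrite puE (bigD1 g) //= ltr_pwDl ?pos ?sumr_ge0.
Qed.

Lemma pu_b0 alpha u x :
  pu R d u x * b0 d alpha u x = \sum_(g | active u g x) stand_val alpha g x.
Proof.
rewrite /b0 mulVKf ?gt_eqF ?pu_gt0 //.
by case: x => h [k|] //=; apply: eq_bigl => g; rewrite inE.
Qed.

Lemma pu_b1 alpha u x :
  pu R d u x * b1 d alpha u x = \sum_(g | active u g x) draw_val alpha g x.
Proof.
rewrite /b1 mulVKf ?gt_eqF ?pu_gt0 //.
by case: x => h [k|] //=; apply: eq_bigl => g; rewrite inE.
Qed.

Lemma pu_gain alpha u x : pu R d u x * gain d alpha u x = total_excess alpha u x.
Proof. by rewrite /gain mulrBr pu_b0 pu_b1 -sumrB. Qed.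

Lemma total_excess27 alpha x : total_excess alpha 27 x =
  total_excess alpha 19 x + side R x.2 * excess alpha (hand_lit 1 4) x.
Proof.
rewrite /total_excess /active; case: x => h [k|] /=.
  rewrite (bigD1 (hand_lit 1 4)) ?draws27 ?eqxx //= addrC mul1r; congr (_ + _).
  apply: eq_bigl => g; rewrite draws27.
  by have [->|] := eqVneq g (hand_lit 1 4); rewrite ?notin_draws19 //= andbT.
rewrite [X in _ = X + _](bigD1 (hand_lit 1 4)) ?notin_draws19 //= mulN1r addrAC subrr add0r.
by apply: eq_bigl => g; rewrite draws27 negb_or andbC.
Qed.

Definition natural_term alpha : R :=
  - (32 * alpha * dR ^+ 2 * (37120%:R * dR ^+ 2 - 4044 * dR + 109))
    / (52 * dR * (52 * dR - 1) * (52 * dR - 2) * (52 * dR - 3)).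

Lemma banker_payoffE alpha (u : 'I_32) T : banker_payoff d alpha u T =
  natural_term alpha
  + \sum_x \sum_(g | active u g x) stand_val alpha g x
  + \sum_(x in T) total_excess alpha u x.
Proof.
rewrite /banker_payoff -/(natural_term alpha) -!addrA; congr (_ + _).
rewrite [X in _ = X + _](bigID (mem (~: T))) /= -addrA; congr (_ + _).
  by apply: eq_bigr => x _; rewrite pu_b0.
rewrite [X in _ = X + _](eq_bigl (mem T)) => [|x]; last by rewrite !inE negbK.
rewrite -big_split; apply: eq_bigr => x _ /=.
by rewrite pu_b1 -big_split; apply: eq_bigr => g _; rewrite /excess /= subrKC.
Qed.

(** Weighted by the probability of the deal rather than conditional on reaching [x], so that the
    expression is affine in [p] and free of division by [pu]. *)
Definition mean_excess alpha (p : R) x : R :=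
  total_excess alpha 19 x + p * (side R x.2 * excess alpha (hand_lit 1 4) x).

Lemma banker_against_mix alpha p : exists C, forall T,
  \sum_u mix2 (@Ordinal 32 19 isT) (@Ordinal 32 27 isT) p u
     * banker_payoff d alpha u T
  = C + \sum_(x in T) mean_excess alpha p x.
Proof.
pose S (u : nat) : R := \sum_x \sum_(g | active u g x) stand_val alpha g x.
exists (natural_term alpha + (1 - p) * S 19 + p * S 27) => T.
rewrite sum_mix2 !banker_payoffE /= -/(S 19) -/(S 27).
rewrite [X in _ = _ + X](eq_bigr (fun x => (1 - p) * total_excess alpha 19 x + p * total_excess alpha 27 x)).
  by rewrite big_split /= -!mulr_sumr; ring.
by move=> x _; rewrite /mean_excess total_excess27; ring.
Qed.

(** By linearity a mixed strategy of Banker enters Player's payoff only through these marginal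
    drawing probabilities. *)
Definition draw_weight (y : {ffun {set infoset} -> R}) x : R :=
  \sum_T y T * (x \in T)%:R.

(** Player's gain from drawing on [g] instead of standing. The summands are Banker's values at
    commission 0, whence the minus sign, and [side] sets the information sets reached by drawing
    against those reached by standing. *)
Definition draw_edge (y : {ffun {set infoset} -> R}) g : R :=
  - \sum_x side R x.2 * (stand_val 0 g x + draw_weight y x * excess 0 g x).

Lemma player_against_mixed y : mixed y -> exists C, forall u : 'I_32,
  \sum_T y T * player_payoff R d u T
  = C + \sum_g (g \in draws u)%:R * draw_edge y g.
Proof.
move=> [_ y1]; have avg (c : R) : c = \sum_T y T * c by rewrite -mulr_suml y1 mul1r.
pose V g x := stand_val 0 g x + draw_weight y x * excess 0 g x.
have VE g x : V g x = \sum_T y T * (stand_val 0 g x + (x \in T)%:R * excess 0 g x).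
  under [RHS]eq_bigr do rewrite mulrDr mulrA.
  by rewrite big_split /= -avg -mulr_suml.
(* The baseline is Player standing on every hand, when only information sets without a third card
   are reached. *)
exists (- natural_term 0 - \sum_x \sum_g (x.2 == None)%:R * V g x) => u.
have -> : \sum_T y T * player_payoff R d u T = - natural_term 0 -
    \sum_x \sum_g (active u g x)%:R * V g x.
  rewrite -opprD [natural_term 0]avg.
  have -> : \sum_x \sum_g (active u g x)%:R * V g x
     = \sum_T y T * \sum_x \sum_g (active u g x)%:R * (stand_val 0 g x + (x \in T)%:R * excess 0 g x).
    under [RHS]eq_bigr do rewrite mulr_sumr.
    rewrite [RHS]exchange_big; apply: eq_bigr => x _ /=.
    under [RHS]eq_bigr do rewrite mulr_sumr.
    rewrite [RHS]exchange_big; apply: eq_bigr => g _ /=.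
    by rewrite VE mulr_sumr; apply: eq_bigr => T _; rewrite mulrCA.
  rewrite -big_split -sumrN; apply: eq_bigr => T _ /=.
  rewrite /player_payoff banker_payoffE mulrN -mulrDr -addrA; congr (- (_ * (_ + _))).
  rewrite [X in _ + X]big_mkcond -big_split; apply: eq_bigr => x _ /=.
  transitivity (\sum_(g | active u g x) (stand_val 0 g x + (x \in T)%:R * excess 0 g x)).
    rewrite big_split /= -mulr_sumr -/(total_excess 0 u x); congr (_ + _).
    by case: (x \in T); rewrite ?mul1r ?mul0r.
  rewrite big_mkcond; apply: eq_bigr => g _.
  by case: (active u g x); rewrite ?mul1r ?mul0r.
rewrite -addrA; congr (_ + _).
have -> : \sum_g (g \in draws u)%:R * draw_edge y g =
    - \sum_x \sum_g (g \in draws u)%:R * (side R x.2 * V g x).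
  rewrite exchange_big -sumrN; apply: eq_bigr => g _ /=.
  by rewrite /draw_edge mulrN mulr_sumr.
rewrite -opprD -big_split; congr (- _); apply: eq_bigr => x _ /=.
rewrite -big_split; apply: eq_bigr => g _ /=.
by rewrite /active; case: (x) => h [k|]; case: (g \in draws u) => /=; ring.
Qed.

Definition edge_signs (y : {ffun {set infoset} -> R}) : Prop :=
  [/\ 0 <= draw_edge y (hand_lit 0 5), draw_edge y (hand_lit 1 4) = 0,
      draw_edge y (hand_lit 2 3) <= 0, 0 <= draw_edge y (hand_lit 6 9) &
      0 <= draw_edge y (hand_lit 7 8)].

Definition banker_optimal alpha p T : Prop :=
  forall x, (0 < mean_excess alpha p x -> x \in T)
         /\ (mean_excess alpha p x < 0 -> x \notin T).

Lemma banker_optimalP alpha p T :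
  banker_optimal alpha p T <->
  forall T', \sum_u mix2 (@Ordinal 32 19 isT) (@Ordinal 32 27 isT) p u
                * banker_payoff d alpha u T'
          <= \sum_u mix2 (@Ordinal 32 19 isT) (@Ordinal 32 27 isT) p u
                * banker_payoff d alpha u T.
Proof.
have [C CE] := banker_against_mix alpha p.
split=> [/subset_sum_maxP best T'|best].
  by rewrite !CE lerD2l best.
by apply/subset_sum_maxP => T'; have := best T'; rewrite !CE lerD2l.
Qed.

(** As p lies strictly between 0 and 1, Player's support is exactly 19 and 27. The five edges belong
    to independent digits of [u], and all strategies agree on the remaining hands, so payoffs are
    compared hand by hand. *)
Lemma baccara_nash_intro alpha y :
  0 < player_prob d alpha < 1 -> mixed y -> edge_signs y ->
  (forall T, y T != 0 -> banker_optimal alpha (player_prob d alpha) T) ->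
  baccara_nash d alpha (player_mix d alpha) y.
Proof.
move=> p01 my [e1 e2 e3 e4 e5] best; apply/nashP; split=> //.
- by apply: mixed_mix2; case/andP: p01 => /ltW -> /ltW ->.
- have [C CE] := player_against_mixed my.
  move=> u; rewrite mix2_neq0 // !inE => u_eq u'; rewrite !CE lerD2l.
  have [in05 in23 in69 in78] : [/\ hand_lit 0 5 \in draws u, hand_lit 2 3 \notin draws u,
      hand_lit 6 9 \in draws u & hand_lit 7 8 \in draws u].
    by case/orP: u_eq => /eqP->; split; rewrite in_draws.
  apply: ler_sum => g _.
  have [->|g1] := eqVneq g (hand_lit 0 5).
    by rewrite in05 ler_wpM2r // ler_nat leq_b1.
  have [->|g2] := eqVneq g (hand_lit 1 4); first by rewrite e2 !mulr0.
  have [->|g3] := eqVneq g (hand_lit 2 3).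
    by rewrite (negPf in23) ler_wnM2r // ler_nat.
  have [->|g4] := eqVneq g (hand_lit 6 9).
    by rewrite in69 ler_wpM2r // ler_nat leq_b1.
  have [->|g5] := eqVneq g (hand_lit 7 8).
    by rewrite in78 ler_wpM2r // ler_nat leq_b1.
  by rewrite !in_draws (negPf g1) (negPf g2) (negPf g3) (negPf g4) (negPf g5).
by move=> T /best/banker_optimalP.
Qed.

(** Both 19 and 27 carry weight, hence pay the same, and their payoffs differ exactly by the edge at
    [(1, 4)]. These consequences suffice to count the equilibria at a special value. *)
Lemma baccara_nash_elim alpha y :
  0 < player_prob d alpha < 1 ->
  baccara_nash d alpha (player_mix d alpha) y ->
  [/\ mixed y, draw_edge y (hand_lit 1 4) = 0 &
      forall T, y T != 0 -> banker_optimal alpha (player_prob d alpha) T].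
Proof.
move=> p01 /nashP[_ my bA bB]; split=> //; last first.
  by move=> T yT; apply/banker_optimalP => T'; apply: bB.
have [C CE] := player_against_mixed my.
pose u19 := @Ordinal 32 19 isT; pose u27 := @Ordinal 32 27 isT.
have h19 := bA u19; have h27 := bA u27.
rewrite !mix2_neq0 // !inE eqxx in h19; rewrite mix2_neq0 // !inE eqxx orbT in h27.
have := le_anti (introT andP (conj (h19 isT u27) (h27 isT u19))).
rewrite !CE => /addrI /eqP; rewrite -subr_eq0 -sumrB (bigD1 (hand_lit 1 4)) //=.
rewrite draws27 eqxx notin_draws19 mul1r mul0r subr0 big1 ?addr0 => [/eqP//|g gP].
by rewrite draws27 (negPf gP) subrr.
Qed.

Lemma draw_edge_mix2 T0 T1 q g : draw_edge (mix2 T0 T1 q) g =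
  (1 - q) * - (\sum_x side R x.2 * (stand_val 0 g x + (x \in T0)%:R * excess 0 g x))
  + q * - (\sum_x side R x.2 * (stand_val 0 g x + (x \in T1)%:R * excess 0 g x)).
Proof.
rewrite /draw_edge !mulrN -opprD !mulr_sumr -big_split; congr (- _).
by apply: eq_bigr => x _ /=; rewrite /draw_weight sum_mix2; ring.
Qed.

End Separation.

(** * Integer polynomials and information sets *)

(* Polynomials as coefficient lists, lowest degree first, over the binary
   integers so that the kernel can compute with them. *)
Notation zpoly := (seq Z).

Fixpoint padd (p q : zpoly) : zpoly :=
  match p, q with
  | [::], _ => q
  | _, [::] => p
  | a :: p', b :: q' => Z.add a b :: padd p' q'
  end.

Definition pscale (c : Z) (p : zpoly) : zpoly := map (Z.mul c) p.

Fixpoint pmul (p q : zpoly) : zpoly :=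
  if p is a :: p' then padd (pscale a q) (Z0 :: pmul p' q) else [::].

Definition popp := pscale (Zneg xH).

Definition psub p q := padd p (popp q).

Definition psum (T : Type) (f : T -> zpoly) (s : seq T) : zpoly :=
  foldr (fun t r => padd (f t) r) [::] s.

Fixpoint psubst (p q : zpoly) : zpoly :=
  if p is a :: p' then padd [:: a] (pmul q (psubst p' q)) else [::].

Definition ppos (p : zpoly) : bool :=
  if p is a :: p' then Z.ltb Z0 a && all (Z.leb Z0) p' else false.

Definition pnull (p : zpoly) : bool := all (Z.eqb Z0) p.

Section Evaluation.
Variable R : realType.
Implicit Types (p q : zpoly) (y : R).

Definition zr (c : Z) : R := (int_of_Z c)%:~R.

Definition pev y p : R := foldr (fun c r => zr c + y * r) 0 p.

Lemma zrD a b : zr (Z.add a b) = zr a + zr b.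
Proof. by rewrite /zr -intrD; congr (_ %:~R); rewrite -[LHS]/(int_of_Z (a + b)) rmorphD. Qed.

Lemma zrM a b : zr (Z.mul a b) = zr a * zr b.
Proof. by rewrite /zr -intrM; congr (_ %:~R); rewrite -[LHS]/(int_of_Z (a * b)) rmorphM. Qed.

Lemma zrN a : zr (Z.opp a) = - zr a.
Proof. by rewrite /zr -[Z.opp a]/(- a) !rmorphN. Qed.

Lemma zr_nat (n : nat) : zr (Z.of_nat n) = n%:R.
Proof. by rewrite /zr pmulrn; congr (_ *~ _); case: n => //= n; lia. Qed.

Lemma zr_ge0 a : Z.leb Z0 a -> 0 <= zr a.
Proof. by rewrite /zr ler0z; case: a. Qed.

Lemma zr_gt0 a : Z.ltb Z0 a -> 0 < zr a.
Proof. by rewrite /zr ltr0z; case: a => // a _; rewrite /int_of_Z /=; lia. Qed.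

Lemma pev_nil y : pev y [::] = 0. Proof. by []. Qed.

Lemma pev_cons y a p : pev y (a :: p) = zr a + y * pev y p. Proof. by []. Qed.

Arguments pev : simpl never.

Lemma pev_add y p q : pev y (padd p q) = pev y p + pev y q.
Proof.
elim: p q => [|a p IHp] [|b q]; rewrite ?(add0r, addr0) //= !pev_cons IHp zrD; ring.
Qed.

Lemma pev_scale y c p : pev y (pscale c p) = zr c * pev y p.
Proof.
by elim: p => [|a p IHp] /=; rewrite ?pev_nil ?mulr0 // !pev_cons IHp zrM; ring.
Qed.

Lemma pev_mul y p q : pev y (pmul p q) = pev y p * pev y q.
Proof.
elim: p => [|a p IHp]; first by rewrite pev_nil mul0r.
by rewrite [pmul _ _]/(padd _ (_ :: pmul _ _)) pev_add pev_scale !pev_cons IHp [zr Z0]/zr /=; ring.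
Qed.

Lemma pev_opp y p : pev y (popp p) = - pev y p.
Proof. by rewrite pev_scale /zr /= mulN1r. Qed.

Lemma pev_sub y p q : pev y (psub p q) = pev y p - pev y q.
Proof. by rewrite pev_add pev_opp. Qed.

Lemma pev_sum (T : Type) (f : T -> zpoly) s y :
  pev y (psum f s) = \sum_(t <- s) pev y (f t).
Proof.
elim: s => [|t s IHs]; first by rewrite big_nil.
by rewrite big_cons -IHs -pev_add.
Qed.

Lemma pev_subst y p q : pev y (psubst p q) = pev (pev y q) p.
Proof.
elim: p => // a p IHp.
rewrite [LHS](_ : _ = pev y (padd [:: a] (pmul q (psubst p q)))) //.
by rewrite pev_add pev_mul IHp !pev_cons pev_nil mulr0 addr0.
Qed.

Lemma ppos_gt0 y p : 0 <= y -> ppos p -> 0 < pev y p.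
Proof.
move=> y0; case: p => //= a p /andP[/zr_gt0 a0 pP]; rewrite pev_cons.
apply: ltr_wpDr => //; apply: mulr_ge0 => //; elim: p pP => //= b p IHp /andP[/zr_ge0 b0 /IHp p0].
by rewrite pev_cons; apply: addr_ge0 => //; apply: mulr_ge0.
Qed.

Lemma pnull_eq0 y p : pnull p -> pev y p = 0.
Proof.
elim: p => //= a p IHp /andP[]; case: a => // _ /IHp pE.
by rewrite pev_cons pE mulr0 addr0.
Qed.

End Evaluation.

(** Information sets stripped of ordinals and of their bound proofs, so that enumeration and
    equality run fast in the kernel. *)
Definition infokey : Type := ((nat * nat) * option nat)%type.

Definition key (x : infoset) : infokey := (pips x.1, omap (@nat_of_ord 10) x.2).

Definition hands : seq (nat * nat) :=
  [seq p <- [seq (i, j) | i <- iota 0 10, j <- iota 0 10]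
     | (p.1 <= p.2)%N && (M10 (p.1 + p.2) <= 7)%N].

Definition third_cards : seq (option nat) := None :: map Some (iota 0 10).

Definition infokeys : seq infokey := [seq (h, k) | h <- hands, k <- third_cards].

Lemma key_inj : injective key.
Proof.
move=> [g o] [h o'] /eqP; rewrite xpair_eqE pips_eq => /andP[/eqP/= -> /eqP oo'].
congr pair; by case: o o' oo' => [k|] [k'|] //= [/val_inj ->].
Qed.

Lemma mem_hands p : (p \in hands) =
  [&& (p.1 <= p.2)%N, (M10 (p.1 + p.2) <= 7)%N & (p.2 < 10)%N].
Proof.
have mem2 : (p \in [seq (i, j) | i <- iota 0 10, j <- iota 0 10])
    = (p.1 < 10)%N && (p.2 < 10)%N.
  apply/allpairsP/andP => [[q [q1 q2 ->]]|[p1 p2]].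
    by move: q1 q2; rewrite !mem_iota.
  by exists p; rewrite !mem_iota; case: p {p1 p2} (p1) (p2).
rewrite mem_filter mem2 -andbA; have [p12|//] := boolP (p.1 <= p.2)%N.
do 2!congr (_ && _); have [p2|//] := boolP (p.2 < 10)%N; last by rewrite andbF.
by rewrite (leq_ltn_trans p12 p2).
Qed.

Lemma perm_hands : perm_eq (map pips (index_enum hand)) hands.
Proof.
apply: uniq_perm; first by rewrite map_inj_uniq ?index_enum_uniq //; exact: pips_inj.
- by [].
- move=> p; rewrite mem_hands; apply/mapP/and3P => [[g _ ->]|[p12 p7 p2]].
    by case: g => [[i j] gP] /=; case/andP: (gP) => /= -> ->; rewrite ltn_ord.
  have p1 := leq_ltn_trans p12 p2.
  have gP : ((Ordinal p1, Ordinal p2).1 <= (Ordinal p1, Ordinal p2).2)%N &&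
    (M10 ((Ordinal p1, Ordinal p2).1 + (Ordinal p1, Ordinal p2).2) <= 7)%N by apply/andP.
  exists (exist _ (Ordinal p1, Ordinal p2) gP : hand); first exact: mem_index_enum.
  exact: surjective_pairing.
Qed.

Lemma mem_third_cards o : (o \in third_cards) = if o is Some k then (k < 10)%N else true.
Proof.
rewrite /third_cards in_cons; case: o => [k|] //.
by rewrite mem_map ?mem_iota // => a b [].
Qed.

Lemma mem_infokeys x : key x \in infokeys.
Proof.
apply/allpairsP; exists (key x); split.
- by rewrite -(perm_mem perm_hands) (map_f pips (mem_index_enum x.1)).
- by rewrite mem_third_cards; case: x => h [k|] //=; apply: ltn_ord.
- by case: x.
Qed.

Lemma perm_infokeys : perm_eq (map key (index_enum infoset)) infokeys.
Proof.
apply: uniq_perm; first by rewrite map_inj_uniq ?index_enum_uniq //; exact: key_inj.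
- by vm_compute.
- move=> k; apply/mapP/idP => [[x _ ->]|]; first exact: mem_infokeys.
  case/allpairsP=> -[p o] [pP oP ->]; move: pP oP; rewrite mem_third_cards -(perm_mem perm_hands) => /mapP[h _ ->].
  case: o => [k' k10|_]; last by exists (h, None); rewrite ?mem_index_enum.
  by exists (h, Some (Ordinal k10)); rewrite ?mem_index_enum.
Qed.

Lemma sum_hands (R : realType) (F : nat * nat -> R) (P : pred (nat * nat)) :
  \sum_(g | P (pips g)) F (pips g) = \sum_(p <- hands | P p) F p.
Proof. by rewrite -(perm_big _ perm_hands) big_map. Qed.

Lemma sum_infokeys (R : realType) (F : infokey -> R) :
  \sum_x F (key x) = \sum_(k <- infokeys) F k.
Proof. by rewrite -(perm_big _ perm_infokeys) big_map. Qed.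

(** * Computed payoffs *)

Open Scope Z_scope.

Definition card_count (seen : seq nat) (k : nat) : Z :=
  foldr (fun i c => if Nat.eqb i k then Z.succ c else c) 0 seen.

(* In terms of y = 4 d: y cards of each nonzero value, 4 y zeros, 13 y in all. *)
Definition left_poly (seen : seq nat) (k : nat) : zpoly :=
  [:: Z.opp (card_count seen k); match k with O => 4 | _ => 1 end].

Definition deck_poly (n : Z) : zpoly := [:: Z.opp n; 13].

Definition order_factor (i j : nat) : Z := if Nat.eqb i j then 1 else 2.

Definition deal4 (g h : nat * nat) : zpoly :=
  let: (i1, i2) := g in let: (j1, j2) := h in
  pscale (Z.mul (order_factor i1 i2) (order_factor j1 j2))
    (pmul (left_poly [::] i1) (pmul (left_poly [:: i1] i2)
      (pmul (left_poly [:: i1; i2] j1) (left_poly [:: i1; i2; j1] j2)))).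

Definition seen_cards (g : nat * nat) (k : infokey) : seq nat :=
  match k.2 with
  | Some c => [:: g.1; g.2; k.1.1; k.1.2; c]
  | None => [:: g.1; g.2; k.1.1; k.1.2]
  end.

(** The extra factor [deck_poly 5] when Player stood makes [pmul (rest k) (deal g k)] carry the same
    six deck factors with and without a third card. *)
Definition deal (g : nat * nat) (k : infokey) : zpoly :=
  match k.2 with
  | Some c => pmul (left_poly [:: g.1; g.2; k.1.1; k.1.2] c) (deal4 g k.1)
  | None => pmul (deck_poly 5) (deal4 g k.1)
  end.

(** The number of cards from which Banker would draw. Standing is weighted by it to match the
    denominator of drawing. *)
Definition rest (k : infokey) : zpoly :=
  match k.2 with Some _ => deck_poly 5 | None => deck_poly 4 end.

Definition player_end (g : nat * nat) (k : infokey) : nat :=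
  match k.2 with Some c => M10 (g.1 + g.2 + c) | None => M10 (g.1 + g.2) end.

(* [win alpha b p] is [win_base b p - alpha * win_fee b p]. *)
Definition win_base (b p : nat) : Z :=
  if Nat.ltb p b then 1 else if Nat.eqb p b then 0 else -1.

Definition win_fee (b p : nat) : Z := if Nat.ltb p b then 1 else 0.

Definition stand_poly (wf : nat -> nat -> Z) (g : nat * nat) (k : infokey) :=
  pscale (wf (M10 (k.1.1 + k.1.2)) (player_end g k)) (pmul (rest k) (deal g k)).

Definition excess_poly (wf : nat -> nat -> Z) (g : nat * nat) (k : infokey) :=
  let e := player_end g k in let s := seen_cards g k in
  pmul
    (psub (psum (fun l => pscale (wf (M10 (k.1.1 + k.1.2 + l)) e) (left_poly s l))
                (iota 0 10))
          (pscale (wf (M10 (k.1.1 + k.1.2)) e) (rest k)))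
    (deal g k).

Definition sidez (k : infokey) : Z := if k.2 is Some _ then 1 else -1.

Close Scope Z_scope.

Definition draws19 (p : nat * nat) : bool :=
  [|| (M10 (p.1 + p.2) <= 4)%N, p == (0, 5)%N, p == (6, 9)%N | p == (7, 8)%N].

Definition drawing_hands := Eval vm_compute in filter draws19 hands.
Definition standing_hands := Eval vm_compute in filter (predC draws19) hands.

Definition five_pips : seq (nat * nat) := [:: (0, 5); (1, 4); (2, 3); (6, 9); (7, 8)]%N.

Record info_row := Row {
  row_key : infokey;
  xs_base : zpoly;
  xs_fee : zpoly;
  mix_fee : zpoly;
  edges : seq zpoly }.

(** Index 1 is [(1, 4)] in [five_pips]. The same polynomial contributes to Player's edge there and
    is the coefficient of p in Banker's excess at commission 0. *)
Definition mix_base r := nth [::] (edges r) 1.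

Definition make_row (k : infokey) : info_row :=
  let hs := if k.2 is Some _ then drawing_hands else standing_hands in
  Row k (psum (excess_poly win_base ^~ k) hs) (psum (excess_poly win_fee ^~ k) hs)
    (pscale (sidez k) (excess_poly win_fee (1, 4)%N k))
    [seq pscale (sidez k) (excess_poly win_base g k) | g <- five_pips].

Definition key_case (k : infokey) : nat * option nat := (M10 (k.1.1 + k.1.2), k.2).

Definition open_key (k : infokey) : bool := key_case k \in open_cases.

Definition open_keys := Eval vm_compute in filter open_key infokeys.
Definition closed_keys := Eval vm_compute in filter (predC open_key) infokeys.

Definition is_draw (m : move) : bool := if m is Draw then true else false.
Definition is_stand (m : move) : bool := if m is Stand then true else false.

Definition closed_draw (k : infokey) : bool :=
  is_draw (closed_move (key_case k).1 (key_case k).2).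

(** Stored as evaluated literals, so that the certificates for all deck numbers share one
    computation; [open_rowsE] lets the kernel confirm it. *)
Definition open_rows : seq info_row := Eval vm_compute in map make_row open_keys.

Definition closed_edges_def : seq zpoly :=
  [seq padd (psum (fun k => pscale (sidez k) (stand_poly win_base g k)) infokeys)
            (psum (fun k => pscale (sidez k) (excess_poly win_base g k))
                  (filter closed_draw closed_keys))
     | g <- five_pips].

Definition closed_edges : seq zpoly := Eval vm_compute in closed_edges_def.

Lemma open_rowsE : open_rows = map make_row open_keys.
Proof. by vm_cast_no_check (erefl open_rows). Qed.

Lemma closed_edgesE : closed_edges = closed_edges_def.
Proof. by vm_cast_no_check (erefl closed_edges). Qed.

(** * Soundness: the computed polynomials are the payoffs times a common denominator *)

Section Soundness.
Variables (R : realType) (d : nat) (hd : (1 <= d)%N).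
Implicit Types (g h : hand) (x : infoset) (alpha : R).

Local Notation dR := (d%:R : R).
Local Notation y := (4 * dR).

(** The positive common denominator of [p4], [p5] and [p6]. *)
Definition deal_scale : R := \prod_(n < 6) (52 * dR - n%:R).

Lemma deal_scale_gt0 : 0 < deal_scale.
Proof. by apply: prodr_gt0 => n _; apply: deck_gt0 => //; apply: leq_trans (ltn_ord n) _. Qed.

Lemma zr_card_count s k :
  zr R (card_count s k) = \sum_(i <- s) delta R k i.
Proof.
elim: s => [|i s IHs]; first by rewrite big_nil.
rewrite big_cons -IHs /= /delta eq_sym.
case: PeanoNat.Nat.eqb_spec => [->|/eqP/negPf->]; last by rewrite add0r.
by rewrite eqxx -Z.add_1_r zrD addrC.
Qed.

Lemma pev_left s k :
  pev y (left_poly s k) = shoe R d k - \sum_(i <- s) delta R k i.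
Proof.
rewrite /left_poly !pev_cons pev_nil mulr0 addr0 zrN zr_card_count addrC; congr (_ - _).
by rewrite /shoe; case: k => [|k]; rewrite natrM /= ?(zr_nat _ 4) ?(zr_nat _ 1); ring.
Qed.

Lemma pev_deck (n : nat) : pev y (deck_poly (Z.of_nat n)) = 52 * dR - n%:R.
Proof.
rewrite /deck_poly !pev_cons pev_nil mulr0 addr0 zrN.
rewrite zr_nat (zr_nat _ 13); ring.
Qed.

Lemma zr_order i j : zr R (order_factor i j) = 2 - delta R i j.
Proof.
rewrite /order_factor /delta.
case: PeanoNat.Nat.eqb_spec => [->|/eqP/negPf->]; rewrite ?eqxx /zr /=; last by rewrite subr0.
by apply/eqP; rewrite eq_sym subr_eq.
Qed.

Lemma pev_deal4 g h : pev y (deal4 (pips g) (pips h)) =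
  p4 R d g h * ((52 * dR - 0%:R) * (52 * dR - 1%:R) * (52 * dR - 2%:R) * (52 * dR - 3%:R)).
Proof.
rewrite p4E // /deal4; case: (pips g) => i1 i2; case: (pips h) => j1 j2.
rewrite pev_scale !pev_mul !pev_left zrM !zr_order.
have := deck_gt0 R hd (n := 0) isT; have := deck_gt0 R hd (n := 1) isT.
have := deck_gt0 R hd (n := 2) isT; have := deck_gt0 R hd (n := 3) isT.
move: (52 * dR - 0%:R) (52 * dR - 1%:R) (52 * dR - 2%:R) (52 * dR - 3%:R).
move: (shoe R d i1 - _) (shoe R d i2 - _) (shoe R d j1 - _) (shoe R d j2 - _).
move: (2 - _) (2 - _) => a b c e f g' w x v u u0 v0 x0 w0.
by field; rewrite !gt_eqF.
Qed.

Lemma deal_scaleE : deal_scale = (52 * dR - 0%:R) * (52 * dR - 1%:R) *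
  (52 * dR - 2%:R) * (52 * dR - 3%:R) * (52 * dR - 4%:R) * (52 * dR - 5%:R).
Proof. by rewrite /deal_scale !big_ord_recr big_ord0 /= mul1r. Qed.

Lemma zr_win alpha (b p : nat) :
  win alpha b p = zr R (win_base b p) - alpha * zr R (win_fee b p).
Proof.
rewrite /win /win_base /win_fee subr_gt0 ltz_nat subr_eq0 eqz_nat.
case: PeanoNat.Nat.ltb_spec0 => [/ssrnat.ltP->|/ssrnat.ltP/negPf->]; first by rewrite /zr /= mulr1.
case: PeanoNat.Nat.eqb_spec => [->|/eqP/negPf pb]; first by rewrite eqxx /zr /= mulr0 subr0.
by rewrite eq_sym pb /zr /= mulr0 subr0.
Qed.

Definition fee_poly (f : (nat -> nat -> Z) -> zpoly) alpha : R :=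
  pev y (f win_base) - alpha * pev y (f win_fee).

Definition end_win (alpha : R) g x (b : nat) : R := win alpha b (player_end (pips g) (key x)).

Lemma stand_val_end alpha g x : stand_val d alpha g x =
  end_win alpha g x (M10 ((pips x.1).1 + (pips x.1).2)) * prob R d g x.
Proof. by case: x => h [k|]. Qed.

Lemma pev_deal g x : pev y (pmul (rest (key x)) (deal (pips g) (key x)))
  = deal_scale * prob R d g x.
Proof.
rewrite deal_scaleE pev_mul; case: x => h [k|].
  rewrite -[rest _]/(deck_poly (Z.of_nat 5)) pev_deck -[deal _ _]/(pmul
    (left_poly [:: (pips g).1; (pips g).2; (pips h).1; (pips h).2] k) (deal4 (pips g) (pips h))).
  rewrite pev_mul pev_deal4 /prob p5E // pev_left.
  have := deck_gt0 R hd (n := 4) isT; move: (52 * dR - 4%:R) => u u0.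
  by field; rewrite gt_eqF.
rewrite -[rest _]/(deck_poly (Z.of_nat 4)) pev_deck -[deal _ _]/(pmul
  (deck_poly (Z.of_nat 5)) (deal4 (pips g) (pips h))).
by rewrite pev_mul pev_deal4 pev_deck /prob; ring.
Qed.

Lemma stand_valE alpha g x : deal_scale * stand_val d alpha g x =
  fee_poly (fun wf => stand_poly wf (pips g) (key x)) alpha.
Proof.
rewrite /fee_poly /stand_poly !pev_scale pev_deal stand_val_end /end_win zr_win.
by rewrite /key /=; ring.
Qed.

Lemma draw_val_end alpha g x : deal_scale * draw_val d alpha g x =
  (\sum_(l < 10) end_win alpha g x (M10 ((pips x.1).1 + (pips x.1).2 + l)) *
     pev y (left_poly (seen_cards (pips g) (key x)) l)) * pev y (deal (pips g) (key x)).
Proof.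
rewrite deal_scaleE mulr_suml; case: x => h [k|].
  rewrite -[deal _ _]/(pmul (left_poly [:: (pips g).1; (pips g).2; (pips h).1; (pips h).2] k)
    (deal4 (pips g) (pips h))) pev_mul pev_deal4 pev_left mulr_sumr; apply: eq_bigr => l _.
  rewrite p6E // p5E // pev_left -/(end_win alpha g (h, Some k) _).
  have := deck_gt0 R hd (n := 4) isT; move: (52 * dR - 4%:R) => u u0.
  have := deck_gt0 R hd (n := 5) isT; move: (52 * dR - 5%:R) => v v0.
  by rewrite /seen_cards /=; field; rewrite !gt_eqF.
rewrite -[deal _ _]/(pmul (deck_poly (Z.of_nat 5)) (deal4 (pips g) (pips h))).
rewrite pev_mul pev_deal4 pev_deck mulr_sumr; apply: eq_bigr => l _.
rewrite p5E // pev_left -/(end_win alpha g (h, None) _).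
have := deck_gt0 R hd (n := 4) isT; move: (52 * dR - 4%:R) => u u0.
by rewrite /seen_cards /=; field; rewrite gt_eqF.
Qed.

Lemma excessE alpha g x : deal_scale * excess d alpha g x =
  fee_poly (fun wf => excess_poly wf (pips g) (key x)) alpha.
Proof.
rewrite /excess mulrBr draw_val_end stand_valE.
pose F wf (l : nat) : R := zr R (wf (M10 ((key x).1.1 + (key x).1.2 + l)) (player_end (pips g) (key x)))
  * pev y (left_poly (seen_cards (pips g) (key x)) l).
have -> : \sum_(l < 10) end_win alpha g x (M10 ((pips x.1).1 + (pips x.1).2 + l)) *
     pev y (left_poly (seen_cards (pips g) (key x)) l) =
    \sum_(l <- iota 0 10) (F win_base l - alpha * F win_fee l).
  rewrite -(big_mkord xpredT (fun l => end_win alpha g x (M10 ((pips x.1).1 + (pips x.1).2 + l)) *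
     pev y (left_poly (seen_cards (pips g) (key x)) l))).
  by apply: eq_bigr => l _; rewrite /end_win zr_win /F /=; ring.
rewrite sumrB -mulr_sumr /fee_poly /stand_poly /excess_poly.
rewrite !(pev_mul, pev_sub, pev_sum, pev_scale).
have FE wf : \sum_(l <- iota 0 10) pev y (pscale (wf (M10 ((key x).1.1 + (key x).1.2 + l))
   (player_end (pips g) (key x))) (left_poly (seen_cards (pips g) (key x)) l)) =
   \sum_(l <- iota 0 10) F wf l by apply: eq_bigr => l _; rewrite pev_scale.
by rewrite !FE; ring.
Qed.

Lemma draws19E g : (g \in draws 19) = draws19 (pips g).
Proof.
rewrite in_draws; have [-> -> -> -> ->] : [/\ digit 19 1 = true, digit 19 2 = false,
  digit 19 3 = false, digit 19 4 = true & digit 19 5 = true] by [].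
by rewrite -!pips_eq !andbT !andbF.
Qed.

Lemma drawing_handsE : drawing_hands = filter draws19 hands.
Proof. by []. Qed.

Lemma standing_handsE : standing_hands = filter (predC draws19) hands.
Proof. by []. Qed.

Lemma total_excessE alpha x : deal_scale * total_excess d alpha 19 x =
  pev y (xs_base (make_row (key x))) - alpha * pev y (xs_fee (make_row (key x))).
Proof.
rewrite /total_excess mulr_sumr /make_row /=.
under eq_bigr do rewrite excessE.
set hs := if _ is Some _ then _ else _.
have -> : \sum_(g | active 19 g x) fee_poly (fun wf => excess_poly wf (pips g) (key x)) alpha
    = \sum_(p <- hs) fee_poly (fun wf => excess_poly wf p (key x)) alpha.
  rewrite /hs; case: x @hs => h [k|] /=; rewrite ?drawing_handsE ?standing_handsE big_filter.
    by rewrite -sum_hands; apply: eq_bigl => g; rewrite /active /= draws19E.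
  by rewrite -sum_hands; apply: eq_bigl => g; rewrite /active /= draws19E.
by rewrite sumrB -mulr_sumr !pev_sum.
Qed.

Lemma zr_side x : zr R (sidez (key x)) = side R x.2.
Proof. by case: x => h [k|]. Qed.

Lemma mix_excessE alpha x :
  deal_scale * (side R x.2 * excess d alpha (hand_lit 1 4) x) =
  pev y (mix_base (make_row (key x))) - alpha * pev y (mix_fee (make_row (key x))).
Proof.
rewrite mulrCA excessE /fee_poly /mix_base /= !pev_scale zr_side.
have -> : pips (hand_lit 1 4) = (1, 4)%N by [].
by ring.
Qed.

Lemma mean_excessE alpha p x : deal_scale * mean_excess d alpha p x =
  (pev y (xs_base (make_row (key x))) - alpha * pev y (xs_fee (make_row (key x))))
  + p * (pev y (mix_base (make_row (key x)))
         - alpha * pev y (mix_fee (make_row (key x)))).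
Proof. by rewrite /mean_excess mulrDr total_excessE mulrCA mix_excessE. Qed.

End Soundness.

(** * Parameters and checks *)

(* [place] is a polynomial in z whose value is y = 4 d: a constant for a given
   d, or [y0 + z] for all d with 4 d >= y0, in which case positivity for all
   z >= 0 is read off the coefficients. *)
Record mixing := Mixing {
  place : zpoly;
  num0 : zpoly; num1 : zpoly;
  den0 : zpoly; den1 : zpoly }.

Definition locate (m : mixing) (p : zpoly) : zpoly := psubst p (place m).

Definition locate_row (m : mixing) (r : info_row) : info_row :=
  Row (row_key r) (locate m (xs_base r)) (locate m (xs_fee r)) (locate m (mix_fee r))
    (map (locate m) (edges r)).

(** Coefficients in alpha of (d0 + alpha d1)(xs_base - alpha xs_fee) + (n0 + alpha n1)(t0 - alpha
    mix_fee), the mean excess multiplied by the denominator of p. *)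
Definition excess_quad (m : mixing) (r : info_row) : zpoly * zpoly * zpoly :=
  let: (n0, n1) := (locate m (num0 m), locate m (num1 m)) in
  let: (d0, d1) := (locate m (den0 m), locate m (den1 m)) in
  let t0 := mix_base r in
  (padd (pmul d0 (xs_base r)) (pmul n0 t0),
   psub (padd (pmul d1 (xs_base r)) (pmul n1 t0))
        (padd (pmul d0 (xs_fee r)) (pmul n0 (mix_fee r))),
   popp (padd (pmul d1 (xs_fee r)) (pmul n1 (mix_fee r)))).

Definition quad_opp (q : zpoly * zpoly * zpoly) :=
  let: (c0, c1, c2) := q in (popp c0, popp c1, popp c2).

Definition quad_null (q : zpoly * zpoly * zpoly) :=
  let: (c0, c1, c2) := q in [&& pnull c0, pnull c1 & pnull c2].

Open Scope Z_scope.

(* Bernstein coefficients of the quadratic on [0, 1/10]. *)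
Definition quad_pos (q : zpoly * zpoly * zpoly) : bool :=
  let: (c0, c1, c2) := q in
  [&& ppos c0, ppos (padd (pscale 20 c0) c1)
    & ppos (padd (pscale 100 c0) (padd (pscale 10 c1) c2))].

(** For an affine function the endpoints suffice: its value at 0 and ten times its value at 1/10. *)
Definition affine_pos (c0 c1 : zpoly) : bool :=
  ppos c0 && ppos (padd (pscale 10 c0) c1).

(** The value at a / (2 * 10^7), cleared of denominators. Half units of 10^-7 are needed because
    rounding intervals end at half-integers. *)
Definition quad_at (q : zpoly * zpoly * zpoly) (a : Z) : zpoly :=
  let: (c0, c1, c2) := q in
  padd (pscale (Z.mul 20000000 20000000) c0)
    (padd (pscale (Z.mul 20000000 a) c1) (pscale (Z.mul a a) c2)).

(* Decreasing on [0, 1/10], with a root that rounds to n / 10^7. *)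
Definition quad_falls (q : zpoly * zpoly * zpoly) (n : Z) : bool :=
  let: (c0, c1, c2) := q in
  let a := Z.mul 2 n in
  [&& Z.ltb 1 n, Z.ltb (Z.add n 1) 1000000, ppos (popp c1), ppos (popp (padd (pscale 5 c1) c2)),
      ppos (quad_at q (Z.sub a 1)) & ppos (popp (quad_at q (Z.add a 1)))].

Close Scope Z_scope.

Definition mixing_ok (m : mixing) : bool :=
  let: (n0, n1) := (locate m (num0 m), locate m (num1 m)) in
  let: (d0, d1) := (locate m (den0 m), locate m (den1 m)) in
  affine_pos n0 n1 && affine_pos (psub d0 n0) (psub d1 n1).

Definition row_sign_ok (m : mixing) (drawn : bool) (r : info_row) : bool :=
  let q := excess_quad m r in if drawn then quad_pos q else quad_pos (quad_opp q).

Open Scope Z_scope.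

Definition one_deck : mixing := Mixing [:: 4] [:: 4] [:: 203] [:: 76] [:: -42].

(* Twice the numerator and the denominator of [player_prob]. *)
Definition many_decks (l : zpoly) : mixing :=
  Mixing l
    (pmul [:: -1; 3] [:: 2; -7; 2]) (pmul [:: 0; 4] [:: 1; -6; 7])
    (pmul [:: 0; 0; 1] [:: -4; 11]) (pmul [:: 0; 0; -2] [:: -1; 3]).

Definition decks (d : nat) : mixing :=
  many_decks [:: Z.mul 4 (Z.of_nat d)].

Definition decks_from (d : nat) : mixing :=
  many_decks [:: Z.mul 4 (Z.of_nat d); 1].

Close Scope Z_scope.

(** One deck is checked apart because its p comes from the indifference at [(8, 8)]; [decks_from 2]
    treats every d >= 2 at once. *)
Definition closed_ok (k : infokey) : bool :=
  let r := make_row k in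
  row_sign_ok one_deck (closed_draw k) (locate_row one_deck r)
  && row_sign_ok (decks_from 2) (closed_draw k) (locate_row (decks_from 2) r).

(** [mix_info] is the information set kept indifferent by p. [thresholds] lists in increasing order
    the sets where Banker's move flips, with the rounded special values; [table] gives the word and
    q, a quotient of polynomials in y, on each interval between them. *)
Record regime := Regime {
  player : mixing;
  mix_info : infoset;
  thresholds : seq (infoset * Z);
  table : seq (word * (zpoly * zpoly)) }.

Definition move_key (w : word) (k : infokey) : move :=
  if open_key k
  then nth Stand (nth [::] w (index (key_case k) open_cases))
                 (index k.1 (compositions (key_case k).1))
  else closed_move (key_case k).1 (key_case k).2.

Definition draw_key w k := is_draw (move_key w k).
Definition stand_key w k := is_stand (move_key w k).

(** The coefficient of p in the excess has no zero on [0, 1/10], so the denominator of [disc] never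
    vanishes and the indifferent p is unique. *)
Definition mix_nonzero (r : info_row) : bool :=
  affine_pos (mix_base r) (popp (mix_fee r)) || affine_pos (popp (mix_base r)) (mix_fee r).

(** Only the open rows depend on the word; the rest of each edge is the constant stored in
    [closed_edges]. *)
Definition edge_sums (m : mixing) (rows : seq info_row) (P : pred infokey) : seq zpoly :=
  [seq padd (locate m (nth [::] closed_edges i))
            (psum (fun r => if P (row_key r) then nth [::] (edges r) i else [::]) rows)
     | i <- iota 0 5].

(* Total edges against the mixture of weights 1 - qn / qd and qn / qd, with the
   sign of Banker's payoff: Player wants to draw where they are negative. *)
Definition mixture_ok (e0 e1 : seq zpoly) (qn qd : zpoly) : bool :=
  let e i := padd (pmul (psub qd qn) (nth [::] e0 i)) (pmul qn (nth [::] e1 i)) in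
  [&& ppos qn, ppos (psub qd qn), ppos (popp (e 0%N)), pnull (e 1%N), ppos (e 2%N),
      ppos (popp (e 3%N)) & ppos (popp (e 4%N))].

Definition entry_ok (m : mixing) rows (e : word * (zpoly * zpoly)) : bool :=
  let: (w, (qn, qd)) := e in
  mixture_ok (edge_sums m rows (draw_key w)) (edge_sums m rows (predC (stand_key w)))
    (locate m qn) (locate m qd).

Definition fix_keys (w : word) (k0 k1 : infokey) (b0 b1 : bool) (k : infokey) : bool :=
  if k == k0 then b0 else if k == k1 then b1 else draw_key w k.

(** With e0 and e1 the edges at [(1, 4)] under two pure strategies, (1 - q) e0 + q e1 = 0 has the
    solution q = - e0 / (e1 - e0). *)
Definition tie_num (e0 : seq zpoly) := popp (nth [::] e0 1).
Definition tie_den (e0 e1 : seq zpoly) := psub (nth [::] e1 1) (nth [::] e0 1).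

(** Standing at [k0] is paired with drawing at [k0]; the move at [k1] is free in each of the two,
    which gives four pairs. *)
Definition tie_ok (m : mixing) rows (w : word) (k0 k1 : infokey) : bool :=
  all (fun ab =>
    let e0 := edge_sums m rows (fix_keys w k0 k1 false ab.1) in
    let e1 := edge_sums m rows (fix_keys w k0 k1 true ab.2) in
    mixture_ok e0 e1 (tie_num e0) (tie_den e0 e1))
  [:: (false, false); (false, true); (true, false); (true, true)].

Definition threshold_ok (m : mixing) (r : info_row) (n : Z) (pre : bool) : bool :=
  let q := excess_quad m r in
  mix_nonzero r && quad_falls (if pre then q else quad_opp q) n.

Definition words (rg : regime) : seq word := map fst (table rg).

Definition pre_draw (rg : regime) (k : infokey) : bool :=
  draw_key (head [::] (words rg)) k.

(** Both tests are required in order to exclude [Mix], which is neither drawing nor standing. *)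
Definition plays (w : word) (k : infokey) (b : bool) : bool :=
  (draw_key w k == b) && (stand_key w k == ~~ b).

(** Open sets are of three kinds: the mixed one, with a quadratic that vanishes identically; the
    i-th threshold, whose move flips between words i and i + 1; and those of constant sign. *)
Definition open_row_ok (rg : regime) (r : info_row) : bool :=
  let k := row_key r in
  if k == key (mix_info rg) then
    [&& mix_nonzero r, quad_null (excess_quad (player rg) r)
      & all (fun w => ~~ draw_key w k && ~~ stand_key w k) (words rg)]
  else let i := index k [seq key t.1 | t <- thresholds rg] in
    let b := pre_draw rg k in
    if (i < size (thresholds rg))%N then
      threshold_ok (player rg) r (nth Z0 (map snd (thresholds rg)) i) b
      && all (fun j => plays (nth [::] (words rg) j) k (if (j <= i)%N then b else ~~ b))
             (iota 0 (size (words rg)))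
    else row_sign_ok (player rg) b r && all (fun w => plays w k b) (words rg).

Definition regime_ok (rg : regime) : bool :=
  let m := player rg in
  let rows := map (locate_row m) open_rows in
  [&& mixing_ok m, all (open_row_ok rg) rows, all (entry_ok m rows) (table rg),
      size (table rg) == (size (thresholds rg)).+1,
      all open_key [seq key t.1 | t <- thresholds rg], open_key (key (mix_info rg)),
      uniq [seq key t.1 | t <- thresholds rg],
      key (mix_info rg) \notin [seq key t.1 | t <- thresholds rg],
      sorted (fun a b => Z.ltb (Z.succ a) b) (map snd (thresholds rg))
    & all (fun t => tie_ok m rows t.1.1 (key (mix_info rg)) (key t.2.1))
          (zip (table rg) (thresholds rg))].

Open Scope Z_scope.

(** [Gam] in terms of y = 4 d: 256 d^2 = 16 y^2, 11 d - 1 = (11 y - 4) / 4 and 52 d - 5 = 13 y -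
    5. *)
Definition gam_poly : zpoly := pmul [:: 0; 0; 4] (pmul [:: -4; 11] [:: -5; 13]).

Definition q1_poly : zpoly * zpoly := ([:: 47; -500; 1646; -1877; 360], gam_poly).
(** Numerator and denominator are doubled because 91776 / 256 = 717 / 2 is not an integer. *)
Definition q2_poly : zpoly * zpoly :=
  ([:: 94; -1000; 3290; -3749; 717], pscale 2 gam_poly).
Definition q3_poly : zpoly * zpoly := ([:: 41; -483; 1629; -1870; 359], gam_poly).
Definition q4_poly : zpoly * zpoly := ([:: 41; -483; 1627; -1867; 358], gam_poly).
Definition q5_poly : zpoly * zpoly :=
  ([:: 82; -966; 3256; -3735; 715], pscale 2 gam_poly).

Definition q_d1 : zpoly * zpoly := ([:: 4519], [:: 10716]).
Definition q_d1' : zpoly * zpoly := ([:: 3991], [:: 10716]).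
Definition q_d2 : zpoly * zpoly := ([:: 17431], [:: 64512]).
Definition q_d2' : zpoly * zpoly := ([:: 192637], [:: 709632]).
Definition q_d2'' : zpoly * zpoly := ([:: 65407], [:: 236544]).
Definition q_d12 : zpoly * zpoly := ([:: 1689974681], [:: 2989264896]).

Close Scope Z_scope.

Definition table_row1 := ([:: SSSSS; SSSSSS; DSSDD; MSSSSD; DDDDDD], q1_poly).
Definition table_row2 := ([:: SSSSS; SSSSSS; DSSDD; MSSSSD; DDDSDD], q2_poly).
Definition table_row3 := ([:: SSSSS; SSSSSS; DDSDD; MSSSSD; DDDDDD], q3_poly).
Definition table_row4 := ([:: SSSSS; SSSSSS; DDDDD; MSSSSD; DDDDDD], q4_poly).
Definition table_row5 := ([:: SSSSS; SSSSSS; DDSDD; MSSSSD; DDDSDD], q5_poly).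

Definition x06 := infoset_stood 0 6.

Definition x33_6 := infoset_lit 3 3 6.
Definition x14_4 := infoset_lit 1 4 4.
Definition x23_4 := infoset_lit 2 3 4.

Open Scope Z_scope.

Definition regime_of (d : nat) : regime :=
  match d with
  | 1%N => Regime one_deck (infoset_stood 8 8) [:: (infoset_lit 5 8 8, 655294)]
      [:: ([:: SSDSD; SSSSDD; SSSSS; SSSSSM; DDDSDD], q_d1);
          ([:: SSDDD; SSSSDD; SSSSS; SSSSSM; DDDSDD], q_d1')]
  | 2%N => Regime (decks 2) x06 [:: (infoset_lit 6 9 4, 46904); (infoset_lit 0 5 4, 281623)]
      [:: ([:: SSSSS; SSSSDD; DSSDD; MSSSSD; DDDSDD], q_d2);
          ([:: SSSSS; SSSSDD; DSSSD; MSSSSD; DDDSDD], q_d2');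
          ([:: SSSSS; SSSSDD; SSSSD; MSSSSD; DDDSDD], q_d2'')]
  | 3%N => Regime (decks 3) x06 [::] [:: table_row2]
  | 4%N => Regime (decks 4) x06 [:: (x33_6, 120709)] [:: table_row1; table_row2]
  | 5%N => Regime (decks 5) x06 [:: (x33_6, 392263)] [:: table_row1; table_row2]
  | 6%N => Regime (decks 6) x06 [:: (x33_6, 569147)] [:: table_row1; table_row2]
  | 7%N => Regime (decks 7) x06 [:: (x33_6, 693518)] [:: table_row1; table_row2]
  | 8%N => Regime (decks 8) x06 [:: (x14_4, 244435); (x33_6, 785740)] [:: table_row3; table_row1; table_row2]
  | 9%N => Regime (decks 9) x06 [:: (x23_4, 56651); (x14_4, 763202); (x33_6, 856851)]
      [:: table_row4; table_row3; table_row1; table_row2]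
  | 10%N => Regime (decks 10) x06 [:: (x23_4, 544215); (x33_6, 913356)] [:: table_row4; table_row3; table_row5]
  | 11%N => Regime (decks 11) x06 [:: (x23_4, 932285); (x33_6, 959335)] [:: table_row4; table_row3; table_row5]
  | 12%N => Regime (decks 12) x06 [:: (x33_6, 997480)]
      [:: table_row4; ([:: SSSSS; SSSSSS; DDDDD; MSSSSD; DDDSDD], q_d12)]
  | _ => Regime (decks_from 13) x06 [::] [:: table_row4]
  end.

Close Scope Z_scope.

Lemma closed_signs : all closed_ok closed_keys.
Proof. vm_cast_no_check (erefl true). Qed.

Lemma decks_from2_ok : mixing_ok (decks_from 2).
Proof. by vm_compute. Qed.

Lemma regimes_ok : all (fun d => regime_ok (regime_of d)) (iota 1 13).
Proof. vm_cast_no_check (erefl true). Qed.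

(** * Quadratics in the commission *)

Definition has_sign (R : realType) (b : bool) (v : R) : bool := if b then 0 < v else v < 0.

Section Quadratics.
Variables (R : realType) (z : R) (z_ge0 : 0 <= z).
Implicit Types (q : zpoly * zpoly * zpoly) (alpha : R).

Definition quad_val q alpha : R :=
  let: (c0, c1, c2) := q in pev z c0 + alpha * pev z c1 + alpha ^+ 2 * pev z c2.

Lemma quad_val_opp q alpha : quad_val (quad_opp q) alpha = - quad_val q alpha.
Proof. by case: q => -[c0 c1] c2 /=; rewrite !pev_opp; ring. Qed.

Lemma quad_null_eq0 q alpha : quad_null q -> quad_val q alpha = 0.
Proof.
case: q => -[c0 c1] c2 /= /and3P[n0 n1 n2].
by rewrite !(pnull_eq0 z) // !mulr0 !addr0.
Qed.

Lemma quad_pos_gt0 q alpha : 0 <= alpha <= 1 / 10 -> quad_pos q -> 0 < quad_val q alpha.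
Proof.
case: q => -[c0 c1] c2 /andP[a0 a1] /= /and3P[].
move=> /(ppos_gt0 z_ge0) p0 /(ppos_gt0 z_ge0) + /(ppos_gt0 z_ge0).
rewrite !(pev_add, pev_scale) (zr_nat _ 20) (zr_nat _ 100) (zr_nat _ 10).
move: (pev z c0) (pev z c1) (pev z c2) p0 => {}c0 {}c1 {}c2 p0 p1 p2.
(* Bernstein form on [0, 1/10], with the weights left unnormalised. *)
have -> : c0 + alpha * c1 + alpha ^+ 2 * c2 =
    (1 - 10 * alpha) ^+ 2 * c0 + alpha * (1 - 10 * alpha) * (20 * c0 + c1)
    + alpha ^+ 2 * (100 * c0 + (10 * c1 + c2)) by ring.
(* Strictness is drawn from the last summand, which vanishes at alpha = 0. *)
have [->|a_neq0] := eqVneq alpha 0; first by rewrite mulr0 subr0 expr1n expr0n /=; lra.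
have a_gt0 : 0 < alpha by rewrite lt_def a_neq0.
apply: ltr_wpDl; last by rewrite mulr_gt0 // exprn_gt0.
have s_ge0 : 0 <= 1 - 10 * alpha by lra.
by rewrite addr_ge0 ?mulr_ge0 ?exprn_ge0 // ltW.
Qed.

Lemma affine_pos_gt0 c0 c1 alpha : 0 <= alpha <= 1 / 10 -> affine_pos c0 c1 ->
  0 < pev z c0 + alpha * pev z c1.
Proof.
move=> /andP[a0 a1] /andP[/(ppos_gt0 z_ge0) p0 /(ppos_gt0 z_ge0)].
rewrite !(pev_add, pev_scale) (zr_nat _ 10).
move: (pev z c0) (pev z c1) p0 => {}c0 {}c1 p0 p1.
have -> : c0 + alpha * c1 = (1 - 10 * alpha) * c0 + alpha * (10 * c0 + c1) by ring.
have [->|a_neq0] := eqVneq alpha 0; first by rewrite mulr0 subr0 mul1r mul0r addr0.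
have a_gt0 : 0 < alpha by rewrite lt_def a_neq0.
have s_ge0 : 0 <= 1 - 10 * alpha by lra.
by rewrite ltr_wpDl ?mulr_gt0 // mulr_ge0 // ltW.
Qed.

(** The root exists by the intermediate value theorem between the two rounding bounds; the signs on
    both sides follow from a negative divided difference. *)
Lemma quad_fallsP q n : quad_falls q n ->
  exists beta, [/\ 0 < beta < 1 / 10,
    `|beta - zr R n / 10 ^+ 7| <= 1 / (2 * 10 ^+ 7), quad_val q beta = 0 &
    forall alpha, 0 <= alpha <= 1 / 10 ->
      (alpha < beta -> 0 < quad_val q alpha) /\ (beta < alpha -> quad_val q alpha < 0)].
Proof.
case: q => -[c0 c1] c2; rewrite /quad_falls => /and5P[].
have -> : Z.ltb (Z.add n 1) 1000000 = Z.ltb Z0 (Z.sub 1000000 (Z.add n 1)) by lia.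
have -> : Z.ltb 1 n = Z.ltb Z0 (Z.sub n 1) by lia.
move=> /(zr_gt0 R) n_gt0 /(zr_gt0 R) n_lt /(ppos_gt0 z_ge0) f1 /(ppos_gt0 z_ge0) f2.
move=> /andP[/(ppos_gt0 z_ge0) lo /(ppos_gt0 z_ge0) hi].
have z10 : zr R 10 = 10 by rewrite (zr_nat _ 10).
have z1 : zr R 1 = 1 by rewrite (zr_nat _ 1).
have z2 : zr R 2 = 2 by rewrite (zr_nat _ 2).
have zK : zr R 1000000 = 10 ^+ 6.
  have /(congr1 (zr R)) -> : Zpos 1000000 = Z.mul (Z.mul 10 (Z.mul 10 10)) (Z.mul 10 (Z.mul 10 10)) by [].
  by rewrite !zrM z10; ring.
have zL : zr R 20000000 = 2 * 10 ^+ 7.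
  have /(congr1 (zr R)) -> : Zpos 20000000 = Z.mul (Z.mul 2 10) 1000000 by [].
  by rewrite !zrM zK z10 z2; ring.
have L0 : 0 < 2 * 10 ^+ 7 :> R by rewrite mulr_gt0 ?exprn_gt0.
(* The scale is made an opaque variable so that the arithmetic below does not expand it. *)
have [L LE] : exists L : R, L = 2 * 10 ^+ 7 by exists (2 * 10 ^+ 7).
rewrite -LE in zL L0.
rewrite -Z.add_opp_r zrD zrN zrD z1 zK in n_lt.
rewrite -Z.add_opp_r zrD zrN z1 in n_gt0.
rewrite pev_opp !(pev_add, pev_scale) (zr_nat _ 5) in f2; rewrite pev_opp in f1.
rewrite /quad_at !(pev_add, pev_scale) -Z.add_opp_r !zrM zrD zrN zrM zL z1 z2 in lo.
rewrite /quad_at pev_opp !(pev_add, pev_scale) !zrM zrD zrM zL z1 z2 in hi.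
rewrite /quad_val; move: (pev z c0) (pev z c1) (pev z c2) (zr R n) f1 f2 lo hi n_gt0 n_lt.
move=> {}c0 {}c1 {}c2 {}n f1 f2 lo hi n0 n1.
pose f t := c0 + t * c1 + t ^+ 2 * c2.
pose p : {poly R} := (c0%:P + c1 *: 'X + c2 *: 'X^2)%R.
have pE t : p.[t] = f t by rewrite !(hornerD, hornerZ, hornerC, hornerX, hornerXn) /f; ring.
pose lower := (2 * n - 1) / L; pose upper := (2 * n + 1) / L.
have f_lower : 0 < f lower.
  have -> : f lower = (L * L * c0 + (L * (2 * n - 1) * c1 + (2 * n - 1) * (2 * n - 1) * c2)) / L ^+ 2.
    by rewrite /f /lower; field; rewrite gt_eqF.
  by rewrite divr_gt0 // exprn_gt0.
have f_upper : f upper < 0.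
  have -> : f upper = - (- (L * L * c0 + (L * (2 * n + 1) * c1 + (2 * n + 1) * (2 * n + 1) * c2)) / L ^+ 2).
    by rewrite /f /upper; field; rewrite gt_eqF.
  by rewrite oppr_lt0 divr_gt0 // exprn_gt0.
have le_lu : lower <= upper.
  by rewrite ler_pM2r ?invr_gt0 // lerD2l (le_trans (lerN10 R)).
(* [poly_ivt] expects a passage from nonpositive to nonnegative, hence the opposite polynomial. *)
have [|beta /andP[b_lo b_hi] /rootP] := @poly_ivt R (- p) lower upper le_lu.
  by rewrite !hornerN !pE oppr_le0 oppr_ge0 !ltW.
rewrite hornerN pE => /eqP; rewrite oppr_eq0 => /eqP f_beta.
have upper_lt : upper < 1 / 10.
  rewrite ltr_pdivrMr // LE (exprS _ 6); move: (10 ^+ 6) n1 => K n1.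
  have -> : 1 / 10 * (2 * (10 * K)) = 2 * K by field.
  by clear -n1; lra.
have lower_gt0 : 0 < lower by rewrite divr_gt0 //; clear -n0; lra.
have fB a b : f b - f a = (b - a) * (c1 + (a + b) * c2) by rewrite /f; ring.
(* As a + b lies in [0, 1/5], the divided difference is a mean of the derivatives [c1] at 0 and (5
   c1 + c2) / 5 at 1/10, both negative. *)
have slope a b : 0 <= a <= 1 / 10 -> 0 <= b <= 1 / 10 -> c1 + (a + b) * c2 < 0.
  move=> /andP[a0 a1] /andP[b0 b1].
  have -> : c1 + (a + b) * c2 = - ((1 - 5 * (a + b)) * - c1 + (a + b) * - (5 * c1 + c2)) by ring.
  rewrite oppr_lt0; have [ab0|ab_neq0] := eqVneq (a + b) 0.
    by rewrite ab0 mulr0 subr0 mul1r mul0r addr0.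
  have ab_gt0 : 0 < a + b by rewrite lt_def ab_neq0 addr_ge0.
  by rewrite ltr_wpDl ?mulr_gt0 // mulr_ge0 ?(ltW f1) //; clear -a0 a1 b0 b1; lra.
have beta0 : 0 < beta by apply: lt_le_trans b_lo.
have beta1 : beta < 1 / 10 by apply: le_lt_trans upper_lt.
have beta01 : 0 <= beta <= 1 / 10 by rewrite !ltW.
exists beta; split=> //; first by rewrite beta0.
- have bL : lower <= beta <= upper by rewrite b_lo.
  have nE : n / 10 ^+ 7 = 2 * n / L by rewrite LE; field.
  have lE : 1 / (2 * 10 ^+ 7) = 1 / L by rewrite LE.
  rewrite nE lE ler_distl; apply/andP; split.
    by apply: le_trans b_lo; rewrite -mulrBl.
  by apply: le_trans b_hi _; rewrite -mulrDl.
- move=> alpha a01; have s := slope _ _ beta01 a01; split=> ab; have fBa := fB beta alpha.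
    have : 0 < f alpha - f beta by rewrite fBa nmulr_lgt0 // subr_lt0.
    by rewrite f_beta subr0.
  have : f alpha - f beta < 0 by rewrite fBa pmulr_rlt0 // subr_gt0.
  by rewrite f_beta subr0.
Qed.


Lemma quad_falls_oppP (b : bool) q n : quad_falls (if b then q else quad_opp q) n ->
  exists beta, [/\ 0 < beta < 1 / 10,
    `|beta - zr R n / 10 ^+ 7| <= 1 / (2 * 10 ^+ 7), quad_val q beta = 0 &
    forall alpha, 0 <= alpha <= 1 / 10 ->
      (alpha < beta -> has_sign b (quad_val q alpha))
      /\ (beta < alpha -> has_sign (~~ b) (quad_val q alpha))].
Proof.
move=> /quad_fallsP[beta [b01 br b0 bs]]; exists beta; split=> //.
  by case: b b0 {bs} => //; rewrite quad_val_opp => /eqP; rewrite oppr_eq0 => /eqP.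
move=> alpha /bs[]; case: b {b0 bs} => //=; rewrite quad_val_opp oppr_gt0 oppr_lt0.
by split.
Qed.

Lemma row_signP (b : bool) q alpha : 0 <= alpha <= 1 / 10 ->
  (if b then quad_pos q else quad_pos (quad_opp q)) -> has_sign b (quad_val q alpha).
Proof.
move=> a01; case: b => /(quad_pos_gt0 a01) //.
by rewrite quad_val_opp oppr_gt0.
Qed.

End Quadratics.

(** * Quadratics, mean excesses and discontinuity functions *)

Section MixingFacts.
Variables (R : realType) (d : nat) (hd : (1 <= d)%N) (m : mixing) (z : R).
Hypotheses (z_ge0 : 0 <= z) (yE : 4 * d%:R = pev z (place m)).
Hypothesis player_probE : forall alpha : R, player_prob d alpha =
  (pev (4 * d%:R) (num0 m) + alpha * pev (4 * d%:R) (num1 m))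
  / (pev (4 * d%:R) (den0 m) + alpha * pev (4 * d%:R) (den1 m)).
Hypothesis m_ok : mixing_ok m.
Implicit Types (x : infoset) (alpha : R).

Local Notation excess_at alpha x := (mean_excess d alpha (player_prob d alpha) x).

Lemma pev_locate p : pev z (locate m p) = pev (4 * d%:R) p.
Proof. by rewrite pev_subst yE. Qed.

Lemma prob_lt alpha : 0 <= alpha <= 1 / 10 ->
  [/\ 0 < pev (4 * d%:R) (den0 m) + alpha * pev (4 * d%:R) (den1 m)
    & 0 < player_prob d alpha < 1].
Proof.
move=> a01; case/andP: m_ok => /(affine_pos_gt0 z_ge0 a01) + /(affine_pos_gt0 z_ge0 a01).
rewrite !pev_sub !pev_locate player_probE.
move: (pev _ (num0 m)) (pev _ (num1 m)) (pev _ (den0 m)) (pev _ (den1 m)) => n0 n1 d0 d1 np dp.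
have d_gt0 : 0 < d0 + alpha * d1.
  have -> : d0 + alpha * d1 = n0 + alpha * n1 + (d0 - n0 + alpha * (d1 - n1)) by ring.
  exact: addr_gt0.
split=> //; rewrite divr_gt0 //= ltr_pdivrMr // mul1r.
by rewrite -subr_gt0 (_ : _ - _ = d0 - n0 + alpha * (d1 - n1)) //; ring.
Qed.

Definition quad_of x := excess_quad m (locate_row m (make_row (key x))).

(** The factor is the dealing denominator times the denominator of p, both positive, so signs and
    zeros carry over. *)
Lemma mean_quad alpha x : 0 <= alpha <= 1 / 10 -> exists2 s : R, 0 < s &
  quad_val z (quad_of x) alpha = s * excess_at alpha x.
Proof.
move=> a01; have [d_gt0 _] := prob_lt a01.
exists (deal_scale R d * (pev (4 * d%:R) (den0 m) + alpha * pev (4 * d%:R) (den1 m))).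
  by rewrite mulr_gt0 ?deal_scale_gt0.
rewrite mulrAC mean_excessE // player_probE /quad_of /excess_quad /quad_val.
have mixE r : mix_base (locate_row m r) = locate m (mix_base r).
  rewrite /mix_base /=; case: (edges r) => [|a [|b s]] //=.
rewrite mixE; cbn [xs_base xs_fee mix_fee locate_row].
rewrite pev_opp !(pev_add, pev_mul, pev_sub) !pev_locate.
move: (pev _ (num0 m)) (pev _ (num1 m)) (pev _ (den0 m)) (pev _ (den1 m)) d_gt0 => n0 n1 d0 d1.
move: (pev _ (xs_base _)) (pev _ (xs_fee _)) (pev _ (mix_base _)) (pev _ (mix_fee _)).
by move=> g0 g1 t0 t1 d_gt0; field; rewrite gt_eqF.
Qed.

Lemma sign_mean b alpha x : 0 <= alpha <= 1 / 10 ->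
  has_sign b (quad_val z (quad_of x) alpha) = has_sign b (excess_at alpha x).
Proof.
move=> a01; have [s s0 ->] := mean_quad x a01.
by case: b => /=; rewrite ?pmulr_rgt0 ?pmulr_rlt0.
Qed.

Lemma row_sign_mean b alpha x : 0 <= alpha <= 1 / 10 ->
  row_sign_ok m b (locate_row m (make_row (key x))) -> has_sign b (excess_at alpha x).
Proof. by move=> a01 /(row_signP z_ge0 a01); rewrite sign_mean. Qed.

Definition mix_effect alpha x : R := side R x.2 * excess d alpha (hand_lit 1 4) x.

Lemma mix_nonzeroP alpha x : 0 <= alpha <= 1 / 10 ->
  mix_nonzero (locate_row m (make_row (key x))) -> mix_effect alpha x != 0.
Proof.
have mixE r : mix_base (locate_row m r) = locate m (mix_base r).
  rewrite /mix_base /=; case: (edges r) => [|a [|b s]] //=.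
move=> a01; rewrite /mix_nonzero mixE => nz.
suff: deal_scale R d * mix_effect alpha x != 0 by rewrite mulf_eq0 negb_or => /andP[].
rewrite mix_excessE //; case/orP: nz => /(affine_pos_gt0 z_ge0 a01);
  cbn [xs_base xs_fee mix_fee locate_row]; rewrite ?pev_opp !pev_locate ?mulrN => h.
  by rewrite gt_eqF.
by rewrite lt_eqF // -oppr_gt0 opprD opprK.
Qed.

(** With t the effect of [(1, 4)], indifference at p means that the total excesses against 19 and 27
    are - p t and (1 - p) t: they have opposite signs and yield the ratio p. *)
Lemma disc_domP alpha x : 0 <= alpha <= 1 / 10 -> mix_effect alpha x != 0 ->
  excess_at alpha x = 0 ->
  disc_dom d x alpha /\ disc d x alpha = player_prob d alpha.
Proof.
move=> a01 t0 e0; have [_ /andP[p0 p1]] := prob_lt a01.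
have gainE u : gain d alpha u x = total_excess d alpha u x / pu R d u x.
  by rewrite -pu_gain // mulrC mulKf // gt_eqF ?pu_gt0.
have T19 : total_excess d alpha 19 x = - (player_prob d alpha * mix_effect alpha x).
  by apply/eqP; rewrite -addr_eq0 -e0 /mean_excess.
have T27 : total_excess d alpha 27 x = (1 - player_prob d alpha) * mix_effect alpha x.
  by rewrite total_excess27 T19 -/(mix_effect alpha x); ring.
have [u19 u27] : 0 < pu R d 19 x /\ 0 < pu R d 27 x by rewrite !pu_gt0.
split; last first.
  rewrite /disc !pu_gain // T19 T27; move: (player_prob d alpha) (mix_effect alpha x) t0 => p t t0.
  have -> : - (p * t) - (1 - p) * t = - t by ring.
  by field.
rewrite /disc_dom !gainE T19 T27; apply/andP; split.
  rewrite mulrACA pmulr_lle0 ?mulr_gt0 ?invr_gt0 //.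
  move: (player_prob d alpha) (mix_effect alpha x) p0 p1 => p t p0 p1.
  have -> : - (p * t) * ((1 - p) * t) = - (p * (1 - p) * t ^+ 2) by ring.
  by rewrite oppr_le0 mulr_ge0 ?sqr_ge0 // mulr_ge0 ?subr_ge0 // ltW.
apply/orP; right; apply: mulf_neq0; last by rewrite invr_eq0 gt_eqF.
by apply: mulf_neq0 => //; rewrite subr_eq0 gt_eqF.
Qed.

Lemma disc_eqP alpha x : mix_effect alpha x != 0 ->
  disc d x alpha = player_prob d alpha -> excess_at alpha x = 0.
Proof.
move=> t0; rewrite /disc !pu_gain // total_excess27 -/(mix_effect alpha x).
rewrite /mean_excess -/(mix_effect alpha x) => <-; move: (mix_effect _ _) t0 => t t0.
have -> : total_excess d alpha 19 x - (total_excess d alpha 19 x + t) = - t by ring.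
by field.
Qed.

(** Since [x0] is indifferent for every alpha, its discontinuity function equals [player_prob];
    meeting it is therefore indifference at [x]. *)
Lemma crossing_iff x0 x alpha :
  mix_nonzero (locate_row m (make_row (key x0))) ->
  mix_nonzero (locate_row m (make_row (key x))) ->
  quad_null (quad_of x0) ->
  crossing d x0 x alpha <-> 0 < alpha < 1 / 10 /\ quad_val z (quad_of x) alpha = 0.
Proof.
move=> nz0 nz null0.
have zero a y : 0 <= a <= 1 / 10 -> (quad_val z (quad_of y) a = 0 <-> excess_at a y = 0).
  move=> a01; have [s s0 ->] := mean_quad y a01.
  by split=> [/eqP|->]; rewrite ?mulr0 // mulf_eq0 gt_eqF //= => /eqP.
split=> [[a01 d0 dx dd]|[a01 qz]].
  have a01' : 0 <= alpha <= 1 / 10 by case/andP: a01 => *; rewrite !ltW.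
  split=> //; apply/zero => //; apply: disc_eqP; first exact: mix_nonzeroP.
  rewrite -dd; apply: (disc_domP _ _ _).2 => //; first exact: mix_nonzeroP.
  by apply/zero => //; apply: quad_null_eq0.
have a01' : 0 <= alpha <= 1 / 10 by case/andP: a01 => *; rewrite !ltW.
have [|D0 E0] := disc_domP a01' (mix_nonzeroP a01' nz0).
  by apply/zero => //; apply: quad_null_eq0.
have [|D1 E1] := disc_domP a01' (mix_nonzeroP a01' nz); first by apply/zero.
by split=> //; rewrite E0.
Qed.

End MixingFacts.

(** * Player's edges *)

Definition keyset (P : pred infokey) : {set infoset} := [set x | P (key x)].

Section SupportTwo.
Variables (R : realType) (T : finType).
Implicit Types (s t : T) (w : R).

Lemma mix2_sym s t w : mix2 s t w = mix2 t s (1 - w).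
Proof. by apply/ffunP => u; rewrite !ffunE opprB addrC subrKC. Qed.

Lemma support_two (y : {ffun T -> R}) : mixed y -> #|[set t | y t != 0]| = 2%N ->
  exists s t w, [/\ s != t, 0 < w < 1 & y = mix2 s t w].
Proof.
move=> [y0 y1] /eqP/cards2P[s [t [st yE]]]; exists s, t, (y t).
have yP u : (y u != 0) = (u \in [set s; t]) by rewrite -yE inE.
have ys : y s = 1 - y t.
  rewrite -y1 (bigD1 s) //= (bigD1 t) 1?eq_sym //= big1 ?addr0 ?addrK // => u /andP[us ut].
  by apply/eqP/negbNE; rewrite yP !inE (negPf us) (negPf ut).
have y_gt0 u : u \in [set s; t] -> 0 < y u by rewrite -yP lt_def y0 andbT.
split=> //; first by rewrite y_gt0 ?set22 //= -subr_gt0 -ys y_gt0 ?set21.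
apply/ffunP => u; rewrite ffunE.
have [->|us] := eqVneq u s; first by rewrite (negPf st) mulr0 addr0 mulr1.
have [->|ut] := eqVneq u t; first by rewrite mulr0 mulr1 add0r.
by rewrite !mulr0 addr0; apply/eqP/negbNE; rewrite yP !inE (negPf us) (negPf ut).
Qed.

End SupportTwo.

Section Edges.
Variables (R : realType) (d : nat) (hd : (1 <= d)%N) (m : mixing) (z : R).
Hypotheses (z_ge0 : 0 <= z) (yE : 4 * d%:R = pev z (place m)).

Definition edge_val g (T : {set infoset}) : R :=
  \sum_x side R x.2 * (stand_val d 0 g x + (x \in T)%:R * excess d 0 g x).

Local Notation rows := (map (locate_row m) open_rows).

Definition respects_closed (P : pred infokey) :=
  forall k, ~~ open_key k -> P k = closed_draw k.

(** Standing values are summed over all keys, and excesses split into the closed part, independent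
    of [P], and the open rows. [edge_val] carries Banker's sign, opposite to [draw_edge]. *)
Lemma edge_sumsE P i : (i < 5)%N -> respects_closed P ->
  deal_scale R d * edge_val (nth (hand_lit 0 5) five_hands i) (keyset P) =
  pev z (nth [::] (edge_sums m rows P) i).
Proof.
move=> i5 closedP; set g := nth _ five_hands i.
have pg : pips g = nth (0, 0)%N five_pips i by rewrite /g; case: i i5 {g} => [|[|[|[|[]]]]].
pose S k : R := zr R (sidez k) * pev (4 * d%:R) (stand_poly win_base (pips g) k).
pose X k : R := zr R (sidez k) * pev (4 * d%:R) (excess_poly win_base (pips g) k).
have -> : deal_scale R d * edge_val g (keyset P) =
    \sum_(k <- infokeys) (S k + (P k)%:R * X k).
  rewrite -sum_infokeys mulr_sumr; apply: eq_bigr => x _.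
  rewrite mulrCA mulrDr mulrCA stand_valE // excessE // /fee_poly !mul0r !subr0.
  by rewrite /S /X zr_side inE; ring.
have -> : pev z (nth [::] (edge_sums m rows P) i) =
    pev (4 * d%:R) (nth [::] closed_edges i)
    + \sum_(k <- open_keys) (P k)%:R * X k.
  rewrite /edge_sums (nth_map 0%N) ?size_iota // nth_iota // add0n pev_add pev_sum.
  rewrite (pev_locate yE) big_map open_rowsE big_map; congr (_ + _).
  apply: eq_bigr => k _; rewrite -[row_key _]/k -[edges _]/(map (locate m)
    [seq pscale (sidez k) (excess_poly win_base p k) | p <- five_pips]).
  case: (P k); last by rewrite mul0r.
  rewrite mul1r (nth_map [::]) ?size_map // (nth_map (0, 0)%N) //.
  by rewrite (pev_locate yE) pev_scale -pg.
have -> : pev (4 * d%:R) (nth [::] closed_edges i) =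
    \sum_(k <- infokeys) S k + \sum_(k <- closed_keys | closed_draw k) X k.
  rewrite closed_edgesE /closed_edges_def (nth_map (0, 0)%N) // pev_add !pev_sum -pg.
  by rewrite big_filter; congr (_ + _); apply: eq_bigr => k _; rewrite pev_scale.
rewrite big_split -addrA; congr (_ + _) => /=.
rewrite (bigID open_key) /= addrC; congr (_ + _); last by rewrite -big_filter.
rewrite -big_filter big_seq [RHS]big_mkcond [RHS]big_seq; apply: eq_bigr => k.
rewrite mem_filter => /andP[/closedP -> _].
by case: (closed_draw k); rewrite ?mul1r ?mul0r.
Qed.

Lemma draw_edge_mix T0 T1 (q : R) g : draw_edge d (mix2 T0 T1 q) g =
  - ((1 - q) * edge_val g T0 + q * edge_val g T1).
Proof. by rewrite draw_edge_mix2 !mulrN opprD. Qed.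

Lemma mixtureP P0 P1 qn qd : respects_closed P0 -> respects_closed P1 ->
  mixture_ok (edge_sums m rows P0) (edge_sums m rows P1) qn qd ->
  [/\ 0 < pev z qn, 0 < pev z qd - pev z qn &
    edge_signs d (mix2 (keyset P0) (keyset P1) (pev z qn / pev z qd))].
Proof.
move=> c0 c1.
pose e i := padd (pmul (psub qd qn) (nth [::] (edge_sums m rows P0) i))
                 (pmul qn (nth [::] (edge_sums m rows P1) i)).
rewrite -[mixture_ok _ _ _ _]/[&& ppos qn, ppos (psub qd qn), ppos (popp (e 0%N)),
  pnull (e 1%N), ppos (e 2%N), ppos (popp (e 3%N)) & ppos (popp (e 4%N))].
move=> /and5P[/(ppos_gt0 z_ge0) n0 /(ppos_gt0 z_ge0) n1].
rewrite pev_sub in n1.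
have d0 : 0 < pev z qd by rewrite -(subrK (pev z qn) (pev z qd)) addr_gt0.
have sc : 0 < deal_scale R d * pev z qd by rewrite mulr_gt0 ?deal_scale_gt0.
have eE i : (i < 5)%N -> pev z (e i) =
    - (deal_scale R d * pev z qd
       * draw_edge d (mix2 (keyset P0) (keyset P1) (pev z qn / pev z qd))
           (nth (hand_lit 0 5) five_hands i)).
  move=> i5; rewrite /e pev_add !pev_mul pev_sub -!edge_sumsE // draw_edge_mix.
  move: (edge_val _ _) (edge_val _ _) (pev z qn) (pev z qd) d0 => v0 v1 a b b0.
  by field; rewrite gt_eqF.
move=> /(ppos_gt0 z_ge0) e0 e1 /and3P[/(ppos_gt0 z_ge0) e2 /(ppos_gt0 z_ge0) e3 /(ppos_gt0 z_ge0) e4].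
split=> //.
rewrite pev_opp eE // opprK pmulr_rgt0 // in e0.
rewrite pev_opp eE // opprK pmulr_rgt0 // in e3.
rewrite pev_opp eE // opprK pmulr_rgt0 // in e4.
rewrite eE // oppr_gt0 pmulr_rlt0 // in e2.
have := pnull_eq0 z e1; rewrite eE // => /eqP; rewrite oppr_eq0 mulf_eq0 gt_eqF //= => /eqP e1'.
by split=> //; apply: ltW.
Qed.

End Edges.

Lemma banker_mixE (R : realType) w (q : R) :
  banker_mix w q = mix2 (keyset (draw_key w)) (keyset (predC (stand_key w))) q.
Proof.
have moveE x : move_at w x = move_key w (key x) by [].
rewrite /banker_mix /keyset; congr mix2; apply/setP => x; rewrite [LHS]inE [RHS]inE moveE //.
by rewrite /= /stand_key; case: (move_key w (key x)).
Qed.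

Lemma closed_plays w k : ~~ open_key k -> plays w k (closed_draw k).
Proof.
move=> /negPf kP; rewrite /plays /draw_key /stand_key /move_key kP /closed_draw /closed_move.
by case: ifP.
Qed.

(** * Equilibria for given parameters *)

Lemma xget_unique (R : realType) (P : R -> Prop) a :
  P a -> (forall b, P b -> b = a) -> xget 0 P = a.
Proof. by move=> Pa uniq_a; apply: uniq_a; apply: (@xgetPex _ 0 P); exists a. Qed.

Section RegimeFacts.
Variables (R : realType) (d : nat) (hd : (1 <= d)%N) (rg : regime) (z : R).
Local Notation m := (player rg).
Local Notation x0 := (mix_info rg).
Local Notation rows := (map (locate_row m) open_rows).
Hypotheses (z_ge0 : 0 <= z) (yE : 4 * d%:R = pev z (place m)).
Hypothesis player_probE : forall alpha : R, player_prob d alpha =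
  (pev (4 * d%:R) (num0 m) + alpha * pev (4 * d%:R) (num1 m))
  / (pev (4 * d%:R) (den0 m) + alpha * pev (4 * d%:R) (den1 m)).
Hypothesis closedE : forall (alpha : R) x, 0 <= alpha <= 1 / 10 -> ~~ open_key (key x) ->
  has_sign (closed_draw (key x)) (mean_excess d alpha (player_prob d alpha) x).
Hypothesis rg_ok : regime_ok rg.
Implicit Types (x : infoset) (alpha : R).

Local Notation excess_at alpha x := (mean_excess d alpha (player_prob d alpha) x).
Local Notation thr_size := (size (thresholds rg)).

Definition thr_info (j : nat) : infoset := (nth (x0, Z0) (thresholds rg) j).1.
Definition thr_digits (j : nat) : Z := (nth (x0, Z0) (thresholds rg) j).2.
Definition word_of (i : nat) : word := nth [::] (words rg) i.
Definition beta (j : nat) : R := xget 0 (crossing d x0 (thr_info j)).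

Lemma regime_okE :
  [&& mixing_ok m, all (open_row_ok rg) rows, all (entry_ok m rows) (table rg),
      size (table rg) == thr_size.+1,
      all open_key [seq key t.1 | t <- thresholds rg], open_key (key x0),
      uniq [seq key t.1 | t <- thresholds rg],
      key x0 \notin [seq key t.1 | t <- thresholds rg],
      sorted (fun a b => Z.ltb (Z.succ a) b) (map snd (thresholds rg))
    & all (fun t => tie_ok m rows t.1.1 (key x0) (key t.2.1))
          (zip (table rg) (thresholds rg))].
Proof. exact: rg_ok. Qed.

Lemma m_ok : mixing_ok m. Proof. by case/and5P: regime_okE. Qed.

Lemma open_row_okP x : open_key (key x) ->
  open_row_ok rg (locate_row m (make_row (key x))).
Proof.
case/and5P: regime_okE => _ + _ _ _ kP; rewrite open_rowsE !all_map => /seq.allP; apply.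
by rewrite -[open_keys]/(filter open_key infokeys) mem_filter kP mem_infokeys.
Qed.

Lemma size_words : size (words rg) = thr_size.+1.
Proof. by case/and5P: regime_okE => _ _ _ /eqP <- _; rewrite size_map. Qed.

Lemma key_x0_open : open_key (key x0).
Proof. by case/and5P: regime_okE => _ _ _ _ /and5P[]. Qed.

Lemma thr_keys j : (j < thr_size)%N ->
  nth (key x0) [seq key t.1 | t <- thresholds rg] j = key (thr_info j).
Proof. by move=> jP; rewrite (nth_map (x0, Z0)). Qed.

Lemma thr_open j : (j < thr_size)%N -> open_key (key (thr_info j)).
Proof.
move=> jP; case/and5P: regime_okE => _ _ _ _ /and5P[/seq.allP op _ _ _ _]; apply: op.
by rewrite -thr_keys // mem_nth ?size_map.
Qed.

Lemma thr_index j : (j < thr_size)%N ->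
  index (key (thr_info j)) [seq key t.1 | t <- thresholds rg] = j.
Proof.
move=> jP; case/and5P: regime_okE => _ _ _ _ /and5P[_ _ uk _ _].
by rewrite -thr_keys // index_uniq ?size_map.
Qed.

Lemma thr_neq_x0 j : (j < thr_size)%N -> (key (thr_info j) == key x0) = false.
Proof.
move=> jP; case/and5P: regime_okE => _ _ _ _ /and5P[_ _ _ nk _]; apply: contraNF nk => /eqP <-.
by rewrite -thr_keys // mem_nth ?size_map.
Qed.

Lemma digits_lt i j : (i < j < thr_size)%N -> Z.ltb (Z.succ (thr_digits i)) (thr_digits j).
Proof.
case/andP=> ij jP; case/and5P: regime_okE => _ _ _ _ /and5P[_ _ _ _ /andP[srt _]].
have tr : transitive (fun a b => Z.ltb (Z.succ a) b) by move=> a b c; lia.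
have := sorted_ltn_nth tr Z0 srt; move=> /(_ i j); rewrite !inE size_map.
move=> /(_ (ltn_trans ij jP) jP ij); rewrite !(nth_map (x0, Z0)) //.
exact: ltn_trans jP.
Qed.

Lemma x0_row : [/\ mix_nonzero (locate_row m (make_row (key x0))),
  quad_null (quad_of m x0) &
  forall i, (i <= thr_size)%N ->
    ~~ draw_key (word_of i) (key x0) && ~~ stand_key (word_of i) (key x0)].
Proof.
have := open_row_okP key_x0_open; rewrite /open_row_ok -[row_key _]/(key x0) eqxx.
case/and3P=> nz q0 /(all_nthP [::]) ws; split=> // i iP.
by apply: ws; rewrite size_words.
Qed.

Lemma thr_row j : (j < thr_size)%N -> let x := thr_info j in
  [/\ mix_nonzero (locate_row m (make_row (key x))),
      quad_falls (if pre_draw rg (key x) then quad_of m x else quad_opp (quad_of m x))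
        (thr_digits j) &
      forall i, (i <= thr_size)%N -> plays (word_of i) (key x)
        (if (i <= j)%N then pre_draw rg (key x) else ~~ pre_draw rg (key x))].
Proof.
move=> jP x; have := open_row_okP (thr_open jP).
rewrite /open_row_ok -[row_key _]/(key x) thr_neq_x0 // thr_index // jP.
rewrite (nth_map (x0, Z0)) // => /andP[/andP[nz qf] /seq.allP pl]; split=> // i iP.
by apply: pl; rewrite mem_iota size_words.
Qed.

Lemma other_row x : open_key (key x) -> key x != key x0 ->
  key x \notin [seq key t.1 | t <- thresholds rg] ->
  row_sign_ok m (pre_draw rg (key x)) (locate_row m (make_row (key x)))
  /\ forall i, (i <= thr_size)%N -> plays (word_of i) (key x) (pre_draw rg (key x)).
Proof.
move=> op nx0 nthr; have := open_row_okP op.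
rewrite /open_row_ok -[row_key _]/(key x) (negPf nx0) memNindex // size_map ltnn.
case/andP=> rs /(all_nthP [::]) ws; split=> // i iP.
by apply: ws; rewrite size_words.
Qed.

Lemma x0_excess alpha : 0 <= alpha <= 1 / 10 -> excess_at alpha x0 = 0.
Proof.
move=> a01; have [_ q0 _] := x0_row.
have [s s0] := mean_quad hd z_ge0 yE player_probE m_ok x0 a01.
by rewrite quad_null_eq0 // => /esym/eqP; rewrite mulf_eq0 gt_eqF //= => /eqP.
Qed.

(** The crossing is the root of a strictly falling or rising quadratic, hence unique, so the chosen
    value [beta] inherits all that is known of the root. *)
Lemma betaP j : (j < thr_size)%N -> let x := thr_info j in
  [/\ crossing d x0 x (beta j), (forall a : R, crossing d x0 x a -> a = beta j),
      `|beta j - zr R (thr_digits j) / 10 ^+ 7| <= 1 / (2 * 10 ^+ 7),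
      0 < beta j < 1 / 10 &
      forall alpha, 0 <= alpha <= 1 / 10 ->
        [/\ alpha < beta j -> has_sign (pre_draw rg (key x)) (excess_at alpha x),
            beta j < alpha -> has_sign (~~ pre_draw rg (key x)) (excess_at alpha x) &
            excess_at (beta j) x = 0]].
Proof.
move=> jP x; have [nz qf _] := thr_row jP; have [nz0 q0 _] := x0_row.
have [b [b01 br b0 bs]] := quad_falls_oppP z_ge0 qf.
have cr a := crossing_iff hd z_ge0 yE player_probE m_ok a nz0 nz q0.
have uniq_b a : crossing d x0 x a -> a = b.
  move=> /cr[a01 qa]; have /bs[lt gt] : 0 <= a <= 1 / 10 by case/andP: a01 => *; rewrite !ltW.
  move: lt gt; rewrite qa; case: (ltgtP a b) => // _ h1 h2.
    by have := h1 isT; case: pre_draw; rewrite /= ltxx.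
  by have := h2 isT; case: pre_draw; rewrite /= ltxx.
have cb : crossing d x0 x b by apply/cr.
rewrite /beta -/x (xget_unique cb uniq_b); split=> // alpha a01.
have [lt gt] := bs alpha a01.
rewrite -!(sign_mean hd z_ge0 yE player_probE m_ok) //; split=> //.
have b01' : 0 <= b <= 1 / 10 by case/andP: b01 => *; rewrite !ltW.
have [s s0] := mean_quad hd z_ge0 yE player_probE m_ok x b01'.
by rewrite b0 => /esym/eqP; rewrite mulf_eq0 gt_eqF //= => /eqP.
Qed.

(** Each rounding errs by at most half a unit, so rounded values more than one unit apart order the
    true ones strictly. *)
Lemma beta_lt i j : (i < j < thr_size)%N -> beta i < beta j.
Proof.
move=> ij; have /andP[i_lt_j jP] := ij; have iP := ltn_trans i_lt_j jP.
have [_ _ bi _ _] := betaP iP; have [_ _ bj _ _] := betaP jP.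
have := digits_lt ij.
have -> : Z.ltb (Z.succ (thr_digits i)) (thr_digits j)
  = Z.ltb Z0 (Z.add (thr_digits j) (Z.opp (Z.add (thr_digits i) 1))) by lia.
move=> /(zr_gt0 R); rewrite zrD zrN zrD (zr_nat _ 1).
move: bi bj; rewrite !ler_distl => /andP[_ bi] /andP[bj _] dij.
apply: le_lt_trans bi _; apply: lt_le_trans bj.
have K0 : 0 < 10 ^+ 7 :> R by rewrite exprn_gt0.
move: (10 ^+ 7) K0 dij => K K0 dij.
rewrite -subr_gt0.
have -> : zr R (thr_digits j) / K - 1 / (2 * K) - (zr R (thr_digits i) / K + 1 / (2 * K))
  = (zr R (thr_digits j) - (zr R (thr_digits i) + 1)) / K by field; rewrite gt_eqF.
by rewrite divr_gt0.
Qed.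

(* At [alpha] between the thresholds [i - 1] and [i], or at one of the two, the
   [i]-th word is strictly optimal where Banker is not indifferent. *)
Lemma sign_plays i alpha x : (i <= thr_size)%N -> 0 <= alpha <= 1 / 10 -> x != x0 ->
  (forall j, (j < thr_size)%N -> x = thr_info j ->
    (j < i)%N && (beta j < alpha) || (i <= j)%N && (alpha < beta j)) ->
  exists2 c, has_sign c (excess_at alpha x) & plays (word_of i) (key x) c.
Proof.
move=> iP a01 nx0 thr.
have [op|cl] := boolP (open_key (key x)); last first.
  by exists (closed_draw (key x)); [apply: closedE | apply: closed_plays].
have kx0 : key x != key x0 by rewrite (inj_eq key_inj).
have [inthr|nthr] := boolP (key x \in [seq key t.1 | t <- thresholds rg]); last first.
  have [rs pl] := other_row op kx0 nthr; exists (pre_draw rg (key x)); last exact: pl.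
  exact: (row_sign_mean hd z_ge0 yE player_probE m_ok).
pose j := index (key x) [seq key t.1 | t <- thresholds rg].
have jP : (j < thr_size)%N by rewrite -(size_map (fun t => key t.1)) index_mem.
have xE : x = thr_info j.
  by apply: key_inj; rewrite -thr_keys // nth_index.
have [_ _ pl] := thr_row jP; have [_ _ _ _ /(_ alpha a01)[lt gt _]] := betaP jP.
have := pl i iP; rewrite -xE in lt gt *; case/orP: (thr j jP xE) => /andP[ij ba].
  by rewrite leqNgt ij /= => pw; exists (~~ pre_draw rg (key x)); first exact: gt.
by rewrite ij => pw; exists (pre_draw rg (key x)); first exact: lt.
Qed.

Lemma plays_optimal i alpha (T : {set infoset}) x :
  (exists2 c, has_sign c (excess_at alpha x) & plays (word_of i) (key x) c) ->
  ((0 < excess_at alpha x -> x \in T) /\ (excess_at alpha x < 0 -> x \notin T))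
  <-> (x \in T) = draw_key (word_of i) (key x).
Proof.
case=> c sc /andP[/eqP -> _]; case: c sc => /= sc; split.
- by case=> /(_ sc).
- by move=> ->; split=> //; rewrite ltNge (ltW sc).
- by case=> _ /(_ sc) /negPf.
- by move=> ->; split=> //; rewrite ltNge (ltW sc).
Qed.

Lemma respects_draw w : respects_closed (draw_key w).
Proof. by move=> k /(closed_plays w) /andP[/eqP]. Qed.

Lemma respects_stand w : respects_closed (predC (stand_key w)).
Proof. by move=> k /(closed_plays w) /andP[_ /eqP] /= ->; rewrite negbK. Qed.

Lemma entry_nash i alpha : (i <= thr_size)%N -> 0 <= alpha <= 1 / 10 ->
  (forall j, (j < thr_size)%N -> (j < i)%N && (beta j < alpha) || (i <= j)%N && (alpha < beta j)) ->
  let e := nth ([::], ([::], [::])) (table rg) i in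
  baccara_nash d alpha (player_mix d alpha)
    (banker_mix e.1 (pev (4 * d%:R) e.2.1 / pev (4 * d%:R) e.2.2)).
Proof.
move=> iP a01 thr e; have [_ p01] := prob_lt z_ge0 yE player_probE m_ok a01.
have szT : (i < size (table rg))%N by case/and5P: regime_okE => _ _ _ /eqP -> _.
have eok : entry_ok m rows e.
  by case/and5P: regime_okE => _ _ /(all_nthP ([::], ([::], [::]))) ok _ _; apply: ok.
have we : e.1 = word_of i by rewrite /word_of /words (nth_map ([::], ([::], [::]))).
rewrite banker_mixE -!(pev_locate yE).
have [] := mixtureP hd z_ge0 yE (respects_draw e.1) (respects_stand e.1)
    (qn := locate m e.2.1) (qd := locate m e.2.2).
  by move: eok; rewrite /entry_ok; case: (e) => w [qn qd].
move=> n0 n1 es; have d0 : 0 < pev z (locate m e.2.2).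
  by rewrite -(subrK (pev z (locate m e.2.1)) (pev z (locate m e.2.2))) addr_gt0.
have q01 : 0 <= pev z (locate m e.2.1) / pev z (locate m e.2.2) <= 1.
  apply/andP; split; first by rewrite divr_ge0 // ltW.
  by rewrite ler_pdivrMr // mul1r -subr_ge0 ltW.
apply: (baccara_nash_intro hd p01 _ es); first exact: mixed_mix2.
move=> T yT x.
have [->|nx0] := eqVneq x x0; first by rewrite x0_excess // ltxx.
have ex := sign_plays iP a01 nx0 (fun j jP _ => thr j jP).
apply/(plays_optimal T ex).
(* The word has no [Mix] at [x], so the two pure strategies of the mixture make the same move
   there. *)
have pw : draw_key (word_of i) (key x) = ~~ stand_key (word_of i) (key x).
  by case: ex => c _ /andP[/eqP -> /eqP ->]; rewrite negbK.
have [TE|TE] : T = keyset (draw_key e.1) \/ T = keyset (predC (stand_key e.1)).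
- move: yT; rewrite ffunE; have [->|_] := eqVneq T (keyset (draw_key e.1)); first by left.
  have [->|_] := eqVneq T (keyset (predC (stand_key e.1))); first by right.
  by rewrite !mulr0 addr0 eqxx.
- by rewrite TE inE we.
- by rewrite TE inE we /= pw.
Qed.

(** * The four equilibria at a special value *)

Section Tie.
Variables (j : nat) (jP : (j < thr_size)%N).
Local Notation x1 := (thr_info j).
Local Notation w := (word_of j).
Local Notation al := (beta j).

Definition tie_set (a b : bool) : {set infoset} :=
  keyset (fix_keys w (key x0) (key x1) a b).

Definition tie_sums a b := edge_sums m rows (fix_keys w (key x0) (key x1) a b).

Definition tie_weight (a b : bool) : R :=
  pev z (tie_num (tie_sums false a)) / pev z (tie_den (tie_sums false a) (tie_sums true b)).

Definition tie_mix (a b : bool) : {ffun {set infoset} -> R} :=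
  mix2 (tie_set false a) (tie_set true b) (tie_weight a b).

Lemma beta01 : 0 <= al <= 1 / 10.
Proof. by have [_ _ _ /andP[b0 b1] _] := betaP jP; rewrite !ltW. Qed.

Lemma x1_neq_x0 : x1 != x0.
Proof. by rewrite -(inj_eq key_inj) thr_neq_x0. Qed.

Lemma tie_sign_plays x : x != x0 -> x != x1 ->
  exists2 c, has_sign c (excess_at al x) & plays w (key x) c.
Proof.
move=> nx0 nx1; apply: sign_plays => //; [exact: ltnW | exact: beta01 |].
move=> j' j'P xE; have [lt|gt|jj] := ltngtP j' j.
- by rewrite (@beta_lt j' j) // lt jP.
- by rewrite (@beta_lt j j') // gt j'P.
- by rewrite xE jj eqxx in nx1.
Qed.

(** Away from [x0] and [x1] the excess is nonzero and dictates the move, so the optimal strategies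
    are counted by the two free bits. *)
Lemma tie_optimal T : banker_optimal d al (player_prob d al) T <->
  T = tie_set (x0 \in T) (x1 \in T).
Proof.
have [_ _ _ _ /(_ al beta01)[_ _ z1]] := betaP jP.
split=> [opt|->].
  apply/setP => x; rewrite inE /fix_keys !(inj_eq key_inj).
  have [->//|nx0] := eqVneq x x0; have [->//|nx1] := eqVneq x x1.
  by have /(plays_optimal T)[+ _] := tie_sign_plays nx0 nx1; apply; apply: opt.
move=> x; have [->|nx0] := eqVneq x x0; first by rewrite x0_excess ?beta01 // ltxx.
have [->|nx1] := eqVneq x x1; first by rewrite z1 ltxx.
apply/(plays_optimal _ (tie_sign_plays nx0 nx1)).
by rewrite inE /fix_keys !(inj_eq key_inj) (negPf nx0) (negPf nx1).
Qed.

Lemma in_tie_set a b : ((x0 \in tie_set a b) = a) * ((x1 \in tie_set a b) = b).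
Proof. by rewrite !inE /fix_keys !eqxx (inj_eq key_inj) (negPf x1_neq_x0). Qed.

Lemma tie_set_neq a b : tie_set false a != tie_set true b.
Proof. by apply/eqP => /setP/(_ x0); rewrite !in_tie_set. Qed.

Lemma respects_fix a b : respects_closed (fix_keys w (key x0) (key x1) a b).
Proof.
move=> k kP; rewrite /fix_keys; have [kE|_] := eqVneq k (key x0).
  by rewrite kE key_x0_open in kP.
have [kE|_] := eqVneq k (key x1); first by rewrite kE thr_open in kP.
exact: respects_draw.
Qed.

Lemma tie_mixture a b : mixture_ok (tie_sums false a) (tie_sums true b)
  (tie_num (tie_sums false a)) (tie_den (tie_sums false a) (tie_sums true b)).
Proof.
case/and5P: regime_okE => _ _ _ /eqP szT /and5P[_ _ _ _ /andP[_ /(all_nthP (([::], ([::], [::])), (x0, Z0))) ok]].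
have := ok j.
have jz : (j < size (zip (table rg) (thresholds rg)))%N.
  by rewrite size_zip szT leq_min ltnS (ltnW jP) jP.
move=> /(_ jz); rewrite nth_zip_cond jz => /seq.allP /(_ (a, b)).
have -> : (nth ([::], ([::], [::])) (table rg) j).1 = w.
  by rewrite /word_of /words (nth_map ([::], ([::], [::]))) // szT ltnS ltnW.
by apply; case: a; case: b.
Qed.

(** Positivity of [tie_num] and of [tie_den] minus [tie_num] says exactly that the two edges at
    [(1, 4)] have strict opposite signs. *)
Lemma tie_weightP a b : [/\ 0 < tie_weight a b < 1,
   edge_signs d (tie_mix a b),
   edge_val R d (hand_lit 1 4) (tie_set false a) < 0 &
   0 < edge_val R d (hand_lit 1 4) (tie_set true b)].
Proof.
have [n0 n1 es] := mixtureP hd z_ge0 yE (respects_fix false a) (respects_fix true b) (tie_mixture a b).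
have sE c e := edge_sumsE hd yE (isT : 1 < 5)%N (respects_fix c e).
have S0 := deal_scale_gt0 R hd.
have d0 : 0 < pev z (tie_den (tie_sums false a) (tie_sums true b)).
  by rewrite -(subrK (pev z (tie_num (tie_sums false a))) (pev z _)) addr_gt0.
split=> //.
- by rewrite /tie_weight divr_gt0 //= ltr_pdivrMr // mul1r -subr_gt0.
- by move: n0; rewrite pev_opp -sE oppr_gt0 pmulr_rlt0.
- by move: n1; rewrite pev_opp pev_sub opprK subrK -sE pmulr_rgt0.
Qed.

Lemma tie_mix_neq0 a b T : (tie_mix a b T != 0) = (T \in [set tie_set false a; tie_set true b]).
Proof. by rewrite mix2_neq0 ?tie_set_neq //; case: (tie_weightP a b). Qed.

Lemma tie_nash a b : baccara_nash d al (player_mix d al) (tie_mix a b)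
  /\ #|[set T | tie_mix a b T != 0]| = 2%N.
Proof.
have [/andP[w0 w1] es _ _] := tie_weightP a b.
have [_ p01] := prob_lt z_ge0 yE player_probE m_ok beta01.
split.
  apply: (baccara_nash_intro hd p01 _ es); first by apply: mixed_mix2; rewrite !ltW.
  by move=> T; rewrite tie_mix_neq0 !inE => /orP[] /eqP ->; apply/tie_optimal; rewrite !in_tie_set.
rewrite (_ : [set T | _] = [set tie_set false a; tie_set true b]) ?cards2 ?tie_set_neq //.
by apply/setP => T; rewrite inE tie_mix_neq0.
Qed.

Lemma tie_complete (y : {ffun {set infoset} -> R}) :
  baccara_nash d al (player_mix d al) y -> #|[set T | y T != 0]| = 2%N ->
  exists ab, y = tie_mix ab.1 ab.2.
Proof.
have [_ p01] := prob_lt z_ge0 yE player_probE m_ok beta01.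
move=> /(baccara_nash_elim hd p01)[my e14 opt] /(support_two my)[S [T [q [ST q01 yq]]]].
have optS : S = tie_set (x0 \in S) (x1 \in S).
  by apply/tie_optimal/opt; rewrite yq mix2_neq0 // set21.
have optT : T = tie_set (x0 \in T) (x1 \in T).
  by apply/tie_optimal/opt; rewrite yq mix2_neq0 // set22.
(* The strategies are named so that [S] stands at [x0]. If both drew there, both edges at [(1, 4)]
   would be positive and no weight could balance them. *)
wlog S0 : S T q ST q01 yq optS optT / x0 \in S = false.
  move=> W; have [xS|] := boolP (x0 \in S); last by move/negPf; apply: (W S T q).
  have [xT|/negPf xT] := boolP (x0 \in T); last first.
    apply: (W T S (1 - q)) => //; rewrite 1?eq_sym //; first by case/andP: q01 => *; lra.
    by rewrite mix2_sym opprB addrC subrK.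
  have [_ _ _ vS] := tie_weightP true (x1 \in S).
  have [_ _ _ vT] := tie_weightP true (x1 \in T).
  move: e14; rewrite yq draw_edge_mix optS optT xS xT => /eqP; rewrite oppr_eq0 gt_eqF //.
  by case/andP: q01 => q0 q1; rewrite addr_gt0 // mulr_gt0 // subr_gt0.
have [_ _ vS _] := tie_weightP (x1 \in S) true.
have T1 : x0 \in T.
  apply: contraT => /negPf xT; have [_ _ vT _] := tie_weightP (x1 \in T) true.
  move: e14; rewrite yq draw_edge_mix optS optT S0 xT => /eqP; rewrite oppr_eq0 lt_eqF //.
  by case/andP: q01 => q0 q1; rewrite -oppr_gt0 opprD -!mulrN addr_gt0 // mulr_gt0 ?oppr_gt0 // subr_gt0.
exists (x1 \in S, x1 \in T) => /=; rewrite S0 in optS; rewrite T1 in optT.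
have [_ [_ e14' _ _ _] _ vT] := tie_weightP (x1 \in S) (x1 \in T).
rewrite yq /tie_mix -optS -optT; congr mix2.
move: e14 e14'; rewrite yq /tie_mix !draw_edge_mix -optS -optT => /eqP + /eqP.
rewrite -optS in vS; rewrite -optT in vT.
rewrite !oppr_eq0 => /eqP h1 /eqP h2; move: vS vT h1 h2.
move: (edge_val R d _ S) (edge_val R d _ T) (tie_weight _ _) => vS vT q' vS0 vT0 h1 h2.
(* Both weights solve the same affine equation, whose slope [vT - vS] is positive. *)
have : (q - q') * (vT - vS) = 0.
  have -> : (q - q') * (vT - vS) = ((1 - q) * vS + q * vT) - ((1 - q') * vS + q' * vT) by ring.
  by rewrite h1 h2 subrr.
move/eqP; rewrite mulf_eq0 => /orP[|/eqP h]; first by rewrite subr_eq0 => /eqP.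
by exfalso; lra.
Qed.

(** The support is recovered from the mixture; membership of [x0] tells its two strategies apart and
    membership of [x1] reads off the bits. *)
Lemma tie_mix_inj a b a' b' : tie_mix a b = tie_mix a' b' -> (a, b) = (a', b').
Proof.
move=> E; have supp T : (T \in [set tie_set false a; tie_set true b])
    = (T \in [set tie_set false a'; tie_set true b']) by rewrite -!tie_mix_neq0 E.
have := supp (tie_set false a); rewrite set21 !inE (negPf (tie_set_neq _ _)) orbF.
move/esym/eqP/setP/(_ x1); rewrite !in_tie_set => ->.
have := supp (tie_set true b); rewrite set22 !inE [_ == tie_set false _]eq_sym.
by rewrite (negPf (tie_set_neq _ _)) => /esym/eqP/setP/(_ x1); rewrite !in_tie_set => ->.
Qed.

Lemma tie_equilibria : exists s : seq {ffun {set infoset} -> R},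
  [/\ uniq s, size s = 4%N & forall y : {ffun {set infoset} -> R}, y \in s <->
      (baccara_nash d al (player_mix d al) y /\ #|[set T | y T != 0]| = 2%N)].
Proof.
pose bs := [:: (false, false); (false, true); (true, false); (true, true)].
exists [seq tie_mix ab.1 ab.2 | ab <- bs]; split=> //.
  by rewrite map_inj_uniq // => -[a b] [a' b'] /tie_mix_inj.
move=> y; split=> [/mapP[ab _ ->]|[ny sy]]; first exact: tie_nash.
by have [[a b] ->] := tie_complete ny sy; apply: (map_f (fun ab => tie_mix ab.1 ab.2)); case: a; case: b.
Qed.

End Tie.

End RegimeFacts.

(** * The parameters of the theorem *)

Open Scope Z_scope.

(* Numerals above 5000 are kept by the parser as [Nat.of_num_uint _]; they must
   not be expanded to unary. *)
Fixpoint uint_to_Z (u : Decimal.uint) (acc : Z) : Z :=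
  let next k := Z.add (Z.mul 10 acc) k in
  match u with
  | Decimal.Nil => acc
  | Decimal.D0 u => uint_to_Z u (next 0)
  | Decimal.D1 u => uint_to_Z u (next 1)
  | Decimal.D2 u => uint_to_Z u (next 2)
  | Decimal.D3 u => uint_to_Z u (next 3)
  | Decimal.D4 u => uint_to_Z u (next 4)
  | Decimal.D5 u => uint_to_Z u (next 5)
  | Decimal.D6 u => uint_to_Z u (next 6)
  | Decimal.D7 u => uint_to_Z u (next 7)
  | Decimal.D8 u => uint_to_Z u (next 8)
  | Decimal.D9 u => uint_to_Z u (next 9)
  end.

Close Scope Z_scope.

Lemma of_nat_uint u : Z.of_nat (Nat.of_num_uint (Number.UIntDecimal u)) = uint_to_Z u Z0.
Proof.
(* The conversion is tail recursive, so the accumulator is generalised before induction on the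
   digits. *)
rewrite /Nat.of_num_uint /Nat.of_uint -[Z0]/(Z.of_nat 0); move: 0%N => acc.
elim: u acc => [//||||||||||] u IHu acc;
  rewrite [LHS]IHu; apply: (congr1 (uint_to_Z u)); rewrite PeanoNat.Nat.tail_mul_spec.
all: lia.
Qed.

Lemma natr_Z (R : realType) (n : nat) (c : Z) : Z.of_nat n = c -> n%:R = zr R c.
Proof. by move=> <-; rewrite zr_nat. Qed.

Section Quotients.
Variables (R : realType) (d : nat) (hd : (1 <= d)%N).

Lemma pev_gam : pev (4 * d%:R) gam_poly = Gam R d.
Proof.
rewrite /gam_poly !pev_mul !pev_cons !pev_nil /Gam.
rewrite (zr_nat R 0) (zr_nat R 4) (zr_nat R 11) (zr_nat R 13).
have -> : zr R (-4) = - 4 by rewrite -(zr_nat R 4) -zrN.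
have -> : zr R (-5) = - 5 by rewrite -(zr_nat R 5) -zrN.
ring.
Qed.

(** Substituting y = 4 d turns the comparison of numerators into a computed identity of polynomials
    in d; [k] is the factor that clears half-integers. *)
Lemma quotientE (n4 n3 n2 n1 n0 : nat) (c4 c3 c2 c1 c0 : Z) (k : nat) (p q : zpoly) :
  Z.of_nat n4 = c4 -> Z.of_nat n3 = c3 -> Z.of_nat n2 = c2 -> Z.of_nat n1 = c1 ->
  Z.of_nat n0 = c0 -> (0 < k)%N ->
  pnull (psub (psubst p [:: Z0; Z.of_nat 4])
           (pscale (Z.of_nat k) [:: c0; Z.opp c1; c2; Z.opp c3; c4])) ->
  q = pscale (Z.of_nat k) gam_poly ->
  (n4%:R * d%:R ^+ 4 - n3%:R * d%:R ^+ 3 + n2%:R * d%:R ^+ 2 - n1%:R * d%:R + n0%:R) / Gam R d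
  = pev (4 * d%:R) p / pev (4 * d%:R) q.
Proof.
move=> h4 h3 h2 h1 h0 k0 /(pnull_eq0 (d%:R : R))/eqP; rewrite pev_sub subr_eq0 => /eqP pE qE.
have -> : pev (4 * d%:R) p = pev (d%:R : R) (psubst p [:: Z0; Z.of_nat 4]).
  by rewrite pev_subst !pev_cons pev_nil !zr_nat (zr_nat R 0) mulr0 addr0 add0r mulrC.
rewrite qE pE !pev_scale pev_gam !pev_cons pev_nil !zrN zr_nat.
rewrite (natr_Z R h4) (natr_Z R h3) (natr_Z R h2) (natr_Z R h1) (natr_Z R h0).
rewrite -mulf_div divff ?mul1r ?pnatr_eq0 -?lt0n //; congr (_ / _); ring.
Qed.

Lemma q1E : q1 R d = pev (4 * d%:R) q1_poly.1 / pev (4 * d%:R) q1_poly.2.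
Proof. by apply: (@quotientE _ _ _ _ _ 92160 120128 26336 2000 47 1); rewrite ?of_nat_uint. Qed.

Lemma q2E : q2 R d = pev (4 * d%:R) q2_poly.1 / pev (4 * d%:R) q2_poly.2.
Proof. by apply: (@quotientE _ _ _ _ _ 91776 119968 26320 2000 47 2); rewrite ?of_nat_uint. Qed.

Lemma q3E : q3 R d = pev (4 * d%:R) q3_poly.1 / pev (4 * d%:R) q3_poly.2.
Proof. by apply: (@quotientE _ _ _ _ _ 91904 119680 26064 1932 41 1); rewrite ?of_nat_uint. Qed.

Lemma q4E : q4 R d = pev (4 * d%:R) q4_poly.1 / pev (4 * d%:R) q4_poly.2.
Proof. by apply: (@quotientE _ _ _ _ _ 91648 119488 26032 1932 41 1); rewrite ?of_nat_uint. Qed.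

Lemma q5E : q5 R d = pev (4 * d%:R) q5_poly.1 / pev (4 * d%:R) q5_poly.2.
Proof. by apply: (@quotientE _ _ _ _ _ 91520 119520 26048 1932 41 2); rewrite ?of_nat_uint. Qed.

Lemma constantE (y : R) (n k : nat) (a b : Z) : Z.of_nat n = a -> Z.of_nat k = b ->
  n%:R / k%:R = pev y [:: a] / pev y [:: b].
Proof.
by move=> /(natr_Z R) -> /(natr_Z R) ->; rewrite !pev_cons !pev_nil !mulr0 !addr0.
Qed.

Lemma player_prob1 alpha : player_prob 1 alpha =
  (pev (4 * 1%:R) (num0 one_deck) + alpha * pev (4 * 1%:R) (num1 one_deck))
  / (pev (4 * 1%:R) (den0 one_deck) + alpha * pev (4 * 1%:R) (den1 one_deck)) :> R.
Proof.
rewrite /player_prob eqxx !pev_cons !pev_nil !mulr0 !addr0.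
rewrite (zr_nat R 4) (zr_nat R 203) (zr_nat R 76).
have -> : zr R (-42) = - 42 by rewrite -(zr_nat R 42) -zrN.
by congr (_ / _); ring.
Qed.

Lemma player_prob_many l alpha : (2 <= d)%N -> player_prob d alpha =
  (pev (4 * d%:R) (num0 (many_decks l)) + alpha * pev (4 * d%:R) (num1 (many_decks l)))
  / (pev (4 * d%:R) (den0 (many_decks l)) + alpha * pev (4 * d%:R) (den1 (many_decks l))) :> R.
Proof.
move=> d2; rewrite /player_prob; case: eqP => [d1|_]; first by rewrite d1 in d2.
rewrite !pev_mul !pev_cons !pev_nil.
have zn k : zr R (Z.opp (Z.of_nat k)) = - k%:R by rewrite zrN zr_nat.
rewrite (zr_nat R 0) (zn 1%N) (zn 7%N) (zn 6%N) (zn 4%N) (zn 2%N).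
rewrite (zr_nat R 1) (zr_nat R 2) (zr_nat R 3) (zr_nat R 4) (zr_nat R 7) (zr_nat R 11).
(* The doubling is forced by 16 d^2 - 14 d + 1 = y^2 - 7 y / 2 + 1. *)
set D := (X in _ / X = _); set N := (X in X / _ = _).
have scale2 (a b : R) : a = 2 * N -> b = 2 * D -> N / D = a / b.
  by move=> -> ->; rewrite -mulf_div divff ?mul1r ?pnatr_eq0.
by apply: scale2; [rewrite /N | rewrite /D]; ring.
Qed.

End Quotients.

Lemma mixing_closed_signs (R : realType) d m (z alpha : R) x : (1 <= d)%N ->
  0 <= z -> 4 * d%:R = pev z (place m) ->
  (forall alpha, player_prob d alpha =
    (pev (4 * d%:R) (num0 m) + alpha * pev (4 * d%:R) (num1 m))
    / (pev (4 * d%:R) (den0 m) + alpha * pev (4 * d%:R) (den1 m)) :> R) ->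
  mixing_ok m ->
  (forall k, closed_ok k -> row_sign_ok m (closed_draw k) (locate_row m (make_row k))) ->
  0 <= alpha <= 1 / 10 -> ~~ open_key (key x) ->
  has_sign (closed_draw (key x)) (mean_excess d alpha (player_prob d alpha) x).
Proof.
move=> hd z0 yE pE mok ok a01 cl; apply: (row_sign_mean hd z0 yE pE mok) => //; apply: ok.
apply: (seq.allP closed_signs).
by rewrite -[closed_keys]/(filter (predC open_key) infokeys) mem_filter /= cl mem_infokeys.
Qed.

Lemma one_deck_ok : mixing_ok one_deck. Proof. by vm_compute. Qed.

(** For d at most 12 the place is constant and z = 0 will do; beyond that z = 4 d - 52. *)
Lemma regime_hyps (R : realType) d : (1 <= d)%N -> exists z : R,
  [/\ 0 <= z, 4 * d%:R = pev z (place (player (regime_of d))),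
    forall alpha, player_prob d alpha =
      (pev (4 * d%:R) (num0 (player (regime_of d)))
       + alpha * pev (4 * d%:R) (num1 (player (regime_of d))))
      / (pev (4 * d%:R) (den0 (player (regime_of d)))
         + alpha * pev (4 * d%:R) (den1 (player (regime_of d)))) :> R,
    forall (alpha : R) x, 0 <= alpha <= 1 / 10 -> ~~ open_key (key x) ->
      has_sign (closed_draw (key x)) (mean_excess d alpha (player_prob d alpha) x)
    & regime_ok (regime_of d)].
Proof.
move=> hd; have rok n : (0 < n < 14)%N -> regime_ok (regime_of n).
  by move=> n14; apply: (seq.allP regimes_ok); rewrite mem_iota.
have [d1|d2] := leqP d 1.
  have -> : d = 1%N by apply/eqP; rewrite eqn_leq d1 hd.
  exists 0; have y1 : 4 * 1%:R = pev (0 : R) (place one_deck).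
    by rewrite pev_cons pev_nil mulr0 addr0 (zr_nat R 4) mulr1.
  split; [exact: lexx | exact: y1 | exact: player_prob1 | | exact: rok].
  move=> alpha x; apply: (mixing_closed_signs _ (lexx 0) y1 (@player_prob1 R) one_deck_ok) => //.
  by move=> k /andP[].
have closed (alpha : R) x : 0 <= alpha <= 1 / 10 -> ~~ open_key (key x) ->
    has_sign (closed_draw (key x)) (mean_excess d alpha (player_prob d alpha) x).
  (* The closed cases have their own parameter 4 d - 8, whatever the regime, since one check serves
     all d >= 2. *)
  have z2 : 0 <= 4 * d%:R - 8 :> R.
    by rewrite subr_ge0 (_ : 8 = 4 * 2%:R) ?ler_pM2l ?ler_nat // -natrM.
  have y2 : 4 * d%:R = pev (4 * d%:R - 8 : R) (place (decks_from 2)).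
    by rewrite !pev_cons pev_nil (zr_nat R 8) (zr_nat R 1); ring.
  have p2 (a : R) := player_prob_many [:: Z.mul 4 (Z.of_nat 2); Zpos xH] a d2.
  have ok2 k : closed_ok k ->
    row_sign_ok (decks_from 2) (closed_draw k) (locate_row (decks_from 2) (make_row k)).
    by case/andP.
  exact: (mixing_closed_signs hd z2 y2 p2 decks_from2_ok ok2).
have [d12|d13] := leqP d 12.
  exists 0; have [l lE] : exists l, player (regime_of d) = many_decks l.
    by move: d d12 d2 {hd closed} => [|[|[|[|[|[|[|[|[|[|[|[|[|//]]]]]]]]]]]]] // _ _; eexists; reflexivity.
  split; [exact: lexx | | | exact: closed |].
  - have -> : player (regime_of d) = decks d.
      by move: d d12 d2 {hd closed l lE} => [|[|[|[|[|[|[|[|[|[|[|[|[|//]]]]]]]]]]]]].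
    by rewrite pev_cons pev_nil mulr0 addr0 zrM (zr_nat R 4) zr_nat.
  - by rewrite lE => alpha; apply: player_prob_many.
  - by apply: rok; rewrite hd ltnS (leq_trans d12).
have rE : regime_of d = regime_of 13.
  by move: d d13 {hd d2 closed} => [|[|[|[|[|[|[|[|[|[|[|[|[|d]]]]]]]]]]]]].
exists (4 * d%:R - 52); rewrite rE; split; [| | | exact: closed | exact: rok].
- by rewrite subr_ge0 (_ : 52 = 4 * 13%:R) ?ler_pM2l ?ler_nat // -natrM.
- rewrite !pev_cons pev_nil (zr_nat R 52) (zr_nat R 1); ring.
- by move=> a; apply: player_prob_many.
Qed.

(** * Lookup of the table entry that belongs to a commission *)

Section Selection.
Variables (R : realType) (A : Type) (e0 : A) (alpha : R).

Fixpoint select (bs : seq R) (es : seq A) : A :=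
  match bs, es with
  | b :: bs', e :: es' => if alpha < b then e else select bs' es'
  | _, _ => head e0 es
  end.

(** The index is the number of thresholds below [alpha]. *)
Lemma selectP bs es : size es = (size bs).+1 -> sorted <%R bs -> alpha \notin bs ->
  exists i, [/\ (i <= size bs)%N, select bs es = nth e0 es i &
    forall j, (j < size bs)%N ->
      (j < i)%N && (nth 0 bs j < alpha) || (i <= j)%N && (alpha < nth 0 bs j)].
Proof.
elim: bs es => [|b bs IHbs] [|e es] //=; first by move=> _ _ _; exists 0%N.
move=> [sz]; rewrite path_sortedE => [/andP[/(all_nthP 0) bmin srt]|]; last exact: lt_trans.
rewrite in_cons negb_or => /andP[ab nab]; have [lt_ab|le_ba] := ltP alpha b.
  exists 0%N; split=> // -[|j] //= jP.
  by rewrite (lt_trans lt_ab) // bmin.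
have [i [iP -> iE]] := IHbs es sz srt nab; exists i.+1; split=> // -[|j] /= jP.
  by rewrite lt_def ab le_ba.
exact: iE.
Qed.

End Selection.

Definition row_value (R : realType) (y : R) (e : word * (zpoly * zpoly)) : word * R :=
  (e.1, pev y e.2.1 / pev y e.2.2).

Lemma special_valuesE (R : realType) d : (1 <= d)%N ->
  special_values R d
  = [seq beta R d (regime_of d) j | j <- iota 0 (size (thresholds (regime_of d)))].
Proof.
by case: d => [|[|[|[|[|[|[|[|[|[|[|[|[|d]]]]]]]]]]]]] // _; rewrite /special_values.
Qed.

Lemma special_digitsE d : (1 <= d)%N ->
  map Z.of_nat (special_digits d) = map snd (thresholds (regime_of d)).
Proof.
case: d => [|[|[|[|[|[|[|[|[|[|[|[|[|d]]]]]]]]]]]]] h; first by [].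
all: cbn [special_digits regime_of thresholds map snd].
all: by do ?[apply: (f_equal2 cons); first exact: of_nat_uint].
Qed.

(** Each case is matched with [select] by conversion while the large numerals stay folded; only then
    are the quotients rewritten as values at y = 4 d. *)
Lemma equilibrium_entryE (R : realType) d (alpha : R) : (1 <= d)%N ->
  equilibrium_entry d alpha = select (row_value (4 * d%:R : R) ([::], ([::], [::]))) alpha
    (special_values R d) (map (row_value (4 * d%:R)) (table (regime_of d))).
Proof.
move=> hd; set y := 4 * d%:R; set e0 := row_value y _.
have v1 : (table_row1.1, q1 R d) = row_value y table_row1 by rewrite q1E.
have v2 : (table_row2.1, q2 R d) = row_value y table_row2 by rewrite q2E.
have v3 : (table_row3.1, q3 R d) = row_value y table_row3 by rewrite q3E.
have v4 : (table_row4.1, q4 R d) = row_value y table_row4 by rewrite q4E.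
have v5 : (table_row5.1, q5 R d) = row_value y table_row5 by rewrite q5E.
case: d hd @y @e0 v1 v2 v3 v4 v5 => [|[|[|[|[|[|[|[|[|[|[|[|[|d]]]]]]]]]]]]] hd y e0 v1 v2 v3 v4 v5;
  first by [].
- have c1 := @constantE R y 4519 10716 4519 10716 erefl (of_nat_uint _).
  have c2 := @constantE R y 3991 10716 3991 10716 erefl (of_nat_uint _).
  transitivity (select e0 alpha (special_values R 1)
    [:: ([:: SSDSD; SSSSDD; SSSSS; SSSSSM; DDDSDD], 4519%:R / 10716%:R);
        ([:: SSDDD; SSSSDD; SSSSS; SSSSSM; DDDSDD], 3991%:R / 10716%:R)]); first reflexivity.
  rewrite [X in (_, X) :: _]c1 [X in _ :: (_, X) :: _]c2; reflexivity.
- have c1 := @constantE R y 17431 64512 17431 64512 (of_nat_uint _) (of_nat_uint _).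
  have c2 := @constantE R y 192637 709632 192637 709632 (of_nat_uint _) (of_nat_uint _).
  have c3 := @constantE R y 65407 236544 65407 236544 (of_nat_uint _) (of_nat_uint _).
  transitivity (select e0 alpha (special_values R 2)
    [:: ([:: SSSSS; SSSSDD; DSSDD; MSSSSD; DDDSDD], 17431%:R / 64512%:R);
        ([:: SSSSS; SSSSDD; DSSSD; MSSSSD; DDDSDD], 192637%:R / 709632%:R);
        ([:: SSSSS; SSSSDD; SSSSD; MSSSSD; DDDSDD], 65407%:R / 236544%:R)]); first reflexivity.
  rewrite [X in (_, X) :: _]c1 [X in _ :: (_, X) :: _]c2 [X in _ :: _ :: (_, X) :: _]c3.
  reflexivity.
- transitivity (select e0 alpha (special_values R 3) [:: (table_row2.1, q2 R 3)]); first reflexivity.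
  rewrite v2; reflexivity.
- transitivity (select e0 alpha (special_values R 4) [:: (table_row1.1, q1 R 4); (table_row2.1, q2 R 4)]); first reflexivity.
  rewrite v1 v2; reflexivity.
- transitivity (select e0 alpha (special_values R 5) [:: (table_row1.1, q1 R 5); (table_row2.1, q2 R 5)]); first reflexivity.
  rewrite v1 v2; reflexivity.
- transitivity (select e0 alpha (special_values R 6) [:: (table_row1.1, q1 R 6); (table_row2.1, q2 R 6)]); first reflexivity.
  rewrite v1 v2; reflexivity.
- transitivity (select e0 alpha (special_values R 7) [:: (table_row1.1, q1 R 7); (table_row2.1, q2 R 7)]); first reflexivity.
  rewrite v1 v2; reflexivity.
- transitivity (select e0 alpha (special_values R 8) [:: (table_row3.1, q3 R 8); (table_row1.1, q1 R 8); (table_row2.1, q2 R 8)]); first reflexivity.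
  rewrite v3 v1 v2; reflexivity.
- transitivity (select e0 alpha (special_values R 9) [:: (table_row4.1, q4 R 9); (table_row3.1, q3 R 9); (table_row1.1, q1 R 9); (table_row2.1, q2 R 9)]); first reflexivity.
  rewrite v4 v3 v1 v2; reflexivity.
- transitivity (select e0 alpha (special_values R 10) [:: (table_row4.1, q4 R 10); (table_row3.1, q3 R 10); (table_row5.1, q5 R 10)]); first reflexivity.
  rewrite v4 v3 v5; reflexivity.
- transitivity (select e0 alpha (special_values R 11) [:: (table_row4.1, q4 R 11); (table_row3.1, q3 R 11); (table_row5.1, q5 R 11)]); first reflexivity.
  rewrite v4 v3 v5; reflexivity.
- have c12 := @constantE R y 1689974681 2989264896 1689974681 2989264896
    (of_nat_uint _) (of_nat_uint _).
  transitivity (select e0 alpha (special_values R 12) [:: (table_row4.1, q4 R 12);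
    ([:: SSSSS; SSSSSS; DDDDD; MSSSSD; DDDSDD], 1689974681%:R / 2989264896%:R)]);
    first reflexivity.
  rewrite v4 [X in _ :: (_, X) :: _]c12; reflexivity.
- transitivity (select e0 alpha (special_values R d.+4.+4.+4.+1) [:: (table_row4.1, q4 R d.+4.+4.+4.+1)]);
    first reflexivity.
  rewrite v4; reflexivity.
Qed.

Section Facts.
Variables (R : realType) (d : nat) (hd : (1 <= d)%N).
Local Notation rg := (regime_of d).
Local Notation n_thr := (size (thresholds rg)).

Lemma crossing_unique j : (j < n_thr)%N ->
  exists! a : R, crossing d (mix_info rg) (thr_info rg j) a.
Proof.
move=> jP; have [z [z0 yE pE cE ok]] := regime_hyps R hd.
have [c u _ _ _] := betaP hd z0 yE pE ok jP.
by exists (beta R d rg j); split=> // a /u.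
Qed.

Lemma size_special : size (special_values R d) = n_thr.
Proof. by rewrite special_valuesE // size_map size_iota. Qed.

Lemma nth_special j : (j < n_thr)%N -> nth 0 (special_values R d) j = beta R d rg j.
Proof. by move=> jP; rewrite special_valuesE // (nth_map 0%N) ?size_iota // nth_iota. Qed.

Lemma size_special_digits : size (special_digits d) = n_thr.
Proof. by rewrite -(size_map Z.of_nat) special_digitsE // size_map. Qed.

Lemma special_rounds j : (j < n_thr)%N ->
  rounds_to (nth 0 (special_values R d) j) (nth 0%N (special_digits d) j).
Proof.
move=> jP; have [z [z0 yE pE cE ok]] := regime_hyps R hd.
have [_ _ br _ _] := betaP hd z0 yE pE ok jP.
rewrite /rounds_to nth_special //; suff -> : (nth 0%N (special_digits d) j)%:R = zr R (thr_digits rg j) by [].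
apply: natr_Z; rewrite -(nth_map 0%N Z0 Z.of_nat) ?size_special_digits // special_digitsE //.
by rewrite (nth_map (mix_info rg, Z0)).
Qed.

Lemma special_sorted : sorted <%R (special_values R d).
Proof.
have [z [z0 yE pE cE ok]] := regime_hyps R hd.
apply/(sortedP 0) => j; rewrite size_special => jP.
by rewrite !nth_special ?(ltnW jP) // (beta_lt hd z0 yE pE ok) ?ltnSn.
Qed.

Lemma equilibrium_away alpha : 0 <= alpha <= 1 / 10 -> alpha \notin special_values R d ->
  baccara_nash d alpha (player_mix d alpha)
    (banker_mix (equilibrium_entry d alpha).1 (equilibrium_entry d alpha).2).
Proof.
move=> a01 nsp; have [z [z0 yE pE cE ok]] := regime_hyps R hd.
have szT : size (map (row_value (4 * d%:R : R)) (table rg)) = (size (special_values R d)).+1.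
  by rewrite size_special size_map -(size_map fst) (size_words ok).
have [i [iP eE thr]] := selectP (row_value (4 * d%:R : R) ([::], ([::], [::]))) szT special_sorted nsp.
rewrite equilibrium_entryE // eE (nth_map ([::], ([::], [::]))); last first.
  by rewrite -(size_map (row_value (4 * d%:R : R))) szT ltnS.
rewrite size_special in iP thr; apply: (entry_nash hd z0 yE pE cE ok iP a01).
by move=> j jP; have := thr j jP; rewrite nth_special.
Qed.

Lemma equilibria_at alpha : alpha \in special_values R d ->
  exists s : seq {ffun {set infoset} -> R},
    [/\ uniq s, size s = 4%N & forall y : {ffun {set infoset} -> R}, y \in s <->
      (baccara_nash d alpha (player_mix d alpha) y /\ #|[set T | y T != 0]| = 2%N)].
Proof.
have [z [z0 yE pE cE ok]] := regime_hyps R hd.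
rewrite special_valuesE // => /mapP[j]; rewrite mem_iota => /andP[_ jP] ->.
exact: (tie_equilibria hd z0 yE pE cE ok jP).
Qed.

End Facts.

Theorem theorem2 (R : realType) (d : nat) (hd : (1 <= d)%N) :
  (* the special values are well defined *)
  [/\ ((4 <= d <= 12)%N -> exists! a : R, is_beta0 d a)
      /\ (d = 1%N -> exists! a : R, is_beta1 d a)
      /\ (d = 2%N -> exists! a : R, is_beta2 d a)
      /\ (d = 2%N -> exists! a : R, is_beta3 d a)
      /\ ((8 <= d <= 9)%N -> exists! a : R, is_beta4 d a)
      /\ ((9 <= d <= 11)%N -> exists! a : R, is_beta5 d a),
  (* their approximate values *)
      size (special_digits d) = size (special_values R d)
      /\ (forall i : nat, (i < size (special_values R d))%N ->
            rounds_to (nth 0 (special_values R d) i)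
                      (nth 0%N (special_digits d) i)),
  (* their number *)
      size (undup (special_values R d)) =
        (if d == 9 then 3
         else if d \in [:: 2; 8; 10; 11] then 2
         else if d \in [:: 1; 4; 5; 6; 7; 12] then 1
         else 0)%N,
  (* the equilibrium away from the special values *)
      forall alpha : R, 0 <= alpha <= 1 / 10 ->
        alpha \notin special_values R d ->
        baccara_nash d alpha (player_mix d alpha)
          (banker_mix (equilibrium_entry d alpha).1
                      (equilibrium_entry d alpha).2) &
  (* the four equilibrium strategies at a special value *)
      forall alpha : R, alpha \in special_values R d ->
        exists s : seq {ffun {set infoset} -> R},
          [/\ uniq s, size s = 4%N &
              forall y : {ffun {set infoset} -> R},
                y \in s <->
                (baccara_nash d alpha (player_mix d alpha) y
                 /\ #|[set T | y T != 0]| = 2%N)]].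
Proof.
split.
- do ![split].
  + move=> /andP[d4 d12]; case: d hd d4 d12 =>
      [|[|[|[|[|[|[|[|[|[|[|[|[|d']]]]]]]]]]]]] hd d4 d12; try by [].
    (* The index is the position of the special value among the thresholds for that deck number. *)
    * exact: (@crossing_unique R 4 hd 0 isT).
    * exact: (@crossing_unique R 5 hd 0 isT).
    * exact: (@crossing_unique R 6 hd 0 isT).
    * exact: (@crossing_unique R 7 hd 0 isT).
    * exact: (@crossing_unique R 8 hd 1 isT).
    * exact: (@crossing_unique R 9 hd 2 isT).
    * exact: (@crossing_unique R 10 hd 1 isT).
    * exact: (@crossing_unique R 11 hd 1 isT).
    * exact: (@crossing_unique R 12 hd 0 isT).
  + by move=> dE; subst d; apply: (@crossing_unique R 1 hd 0 isT).
  + by move=> dE; subst d; apply: (@crossing_unique R 2 hd 0 isT).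
  + by move=> dE; subst d; apply: (@crossing_unique R 2 hd 1 isT).
  + move=> /andP[d8 d9]; case: d hd d8 d9 => [|[|[|[|[|[|[|[|[|[|d']]]]]]]]]] hd d8 d9; try by [].
    * exact: (@crossing_unique R 8 hd 0 isT).
    * exact: (@crossing_unique R 9 hd 1 isT).
  + move=> /andP[d9 d11]; case: d hd d9 d11 => [|[|[|[|[|[|[|[|[|[|[|[|d']]]]]]]]]]]] hd d9 d11; try by [].
    * exact: (@crossing_unique R 9 hd 0 isT).
    * exact: (@crossing_unique R 10 hd 0 isT).
    * exact: (@crossing_unique R 11 hd 0 isT).
- split; first by rewrite size_special_digits // size_special.
  by move=> i; rewrite size_special // => iP; apply: special_rounds.
(* Strict order makes the special values distinct, so their number is the length of the list. *)
- rewrite undup_id ?(lt_sorted_uniq (special_sorted R hd)) // size_special //.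
  by case: d hd => [|[|[|[|[|[|[|[|[|[|[|[|[|d']]]]]]]]]]]]].
- by move=> alpha a01 nsp; apply: equilibrium_away.
- by move=> alpha sp; apply: equilibria_at.
Qed.
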